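(* Let $H$ be either the Hardy space $H^2$ (put $\gamma=1$) or a weighted Bergman space $A^2_\alpha$, $\alpha>-1$ (put $\gamma=\alpha+2$), on the open unit disk $\mathbb{D}$. Let $\varphi$ be an analytic self-map of $\mathbb{D}$ and let $\psi=K_a$ for some $a\in\mathbb{D}$, where $K_a(z)=(1-\overline{a}z)^{-\gamma}$. Then, for the operator $C_{\psi,\varphi}$ on $H$: (a) if $C_{\psi,\varphi}$ is cohyponormal, then $|\varphi(0)|\ge|a|$; (b) if $C_{\psi,\varphi}$ is hyponormal, then $|\varphi(0)|\le|a|$; (c) if $C_{\psi,\varphi}$ is normal, then $|\varphi(0)|=|a|$.
   Context: $H^2$ is the space of analytic $f=\sum \hat f(n)z^n$ on $\mathbb{D}$ with $\|f\|^2=\sum|\hat f(n)|^2<\infty$; $A^2_\alpha$ is the space of analytic $f$ on $\mathbb{D}$ with $\|f\|^2=\int_{\mathbb{D}}|f(z)|^2(\alpha+1)(1-|z|^2)^\alpha\,dA(z)<\infty$, $dA$ normalized area measure. $K_a$ is the reproducing kernel of $H$ at $a$. $C_{\psi,\varphi}f=\psi\cdot(f\circ\varphi)$, which is bounded on $H$ since $\psi$ is bounded. A bounded operator $A$ is hyponormal if $A^*A\ge AA^*$, cohyponormal if $A^*$ is hyponormal, and normal if $A^*A=AA^*$. *)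

(* Defs.v *)
From HB Require Import structures.
From mathcomp Require Import all_boot all_order all_algebra.
From mathcomp Require Import complex.
From mathcomp Require Import all_classical all_reals all_analysis.

Set Implicit Arguments.
Unset Strict Implicit.
Unset Printing Implicit Defensive.

Import Order.TTheory GRing.Theory Num.Theory.
Import numFieldNormedType.Exports.

Local Open Scope classical_set_scope.
Local Open Scope ring_scope.
Local Open Scope complex_scope.

(* Functions on the unit disk are total functions R[i] -> R[i] of which only
   the values on [disk] matter; every notion below depends on them only through
   those values.  The regular module R[i]^o carries the topology of R[i]. *)

Definition disk (R : realType) : set R[i] := [set z | `|z| < 1].

(* The principal value of w ^ s for w in the open right half-plane, where the
   principal argument is atan (Im w / Re w).  It is used below only at
   w = 1 - a^* z with |a z| < 1. *)
Definition cpow (R : realType) (w : R[i]) (s : R) : R[i] :=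
  let r := Normc.normc w `^ s in
  let t := s * atan (complex.Im w / complex.Re w) in
  (r * cos t) +i* (r * sin t).

Definition expands (R : realType) (f : R[i] -> R[i]) (c : nat -> R[i]^o) :=
  forall z, disk z ->
    (series (fun n => c n * z ^+ n) : nat -> R[i]^o) @ \oo --> (f z : R[i]^o).

(* Analyticity on the disk: f is the sum there of its Taylor series at 0. *)
Definition analytic (R : realType) (f : R[i] -> R[i]) :=
  exists c : nat -> R[i]^o, expands f c.

(* The sequence of coefficients \hat f(n), unique when f is analytic. *)
Definition taylor (R : realType) (f : R[i] -> R[i]) : nat -> R[i]^o :=
  get [set c | expands f c].

Definition self_map (R : realType) (phi : R[i] -> R[i]) :=
  analytic phi /\ forall z, disk z -> disk (phi z).

(* [Hardy] stands for H^2 and [Bergman alpha] for A^2_alpha, the latter being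
   meaningful only when -1 < alpha, see [admissible]. *)
Inductive function_space (R : realType) : Type := Hardy | Bergman of R.
Arguments Hardy {R}.

Definition admissible (R : realType) (H : function_space R) : Prop :=
  if H is Bergman alpha then -1 < alpha else True.

Definition gamma (R : realType) (H : function_space R) : R :=
  if H is Bergman alpha then alpha + 2 else 1.

Definition repr_kernel (R : realType) (H : function_space R) (a z : R[i]) : R[i] :=
  cpow (1 - a^* * z) (- gamma H).

Definition pt (R : realType) (p : R * R) : R[i] := p.1 +i* p.2.

Definition area (R : realType) :
    {measure set (measurableTypeR R * measurableTypeR R)%type -> \bar R} :=
  (@lebesgue_measure R \x @lebesgue_measure R)%E.

(* The density of (alpha + 1) (1 - |z|^2)^alpha dA with respect to [area]; the
   factor 1 / pi normalizes the area of the disk to 1. *)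
Definition weight (R : realType) (alpha : R) (z : R[i]) : R :=
  pi^-1 * (alpha + 1) * (1 - Normc.normc z ^+ 2) `^ alpha.

Definition sqnorm (R : realType) (H : function_space R) (f : R[i] -> R[i]) : \bar R :=
  match H with
  | Hardy => (\sum_(n <oo) (Normc.normc (taylor f n) ^+ 2)%:E)%E
  | Bergman alpha =>
      (\int[@area R]_(p in [set p | disk (pt p)])
         (Normc.normc (f (pt p)) ^+ 2 * weight alpha (pt p))%:E)%E
  end.

Definition in_space (R : realType) (H : function_space R) (f : R[i] -> R[i]) : Prop :=
  analytic f /\ (sqnorm H f < +oo)%E.

Definition inner (R : realType) (H : function_space R) (f g : R[i] -> R[i]) : R[i] :=
  match H with
  | Hardy =>
      limn (series (fun n => taylor f n * (taylor g n : R[i])^* : R[i]^o))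
  | Bergman alpha =>
      let h p := f (pt p) * (g (pt p))^* * (weight alpha (pt p))%:C in
      Rintegral (@area R) [set p | disk (pt p)] (fun p => complex.Re (h p))
      +i*
      Rintegral (@area R) [set p | disk (pt p)] (fun p => complex.Im (h p))
  end.

Definition operator (R : realType) := (R[i] -> R[i]) -> (R[i] -> R[i]).

Definition bounded_op (R : realType) (H : function_space R) (A : operator R) : Prop :=
  [/\ forall f, in_space H f -> in_space H (A f),
      forall (c : R[i]) f g, in_space H f -> in_space H g -> forall z, disk z ->
        A (fun w => c * f w + g w) z = c * A f z + A g z
    & exists M : R, forall f, in_space H f ->
        (sqnorm H (A f) <= (M ^+ 2)%:E * sqnorm H f)%E].

(* B = A^*.  A bounded A has exactly one such B, up to values off the disk. *)
Definition adjoint (R : realType) (H : function_space R) (A B : operator R) : Prop :=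
  (forall f, in_space H f -> in_space H (B f)) /\
  (forall f g, in_space H f -> in_space H g -> inner H (A f) g = inner H f (B g)).

(* The order of R[i] makes 0 <= w say that w is real and nonnegative, so the
   last clause is A^* A - A A^* >= 0. *)
Definition hyponormal (R : realType) (H : function_space R) (A : operator R) : Prop :=
  bounded_op H A /\
  exists2 B, adjoint H A B &
    forall f, in_space H f -> 0 <= inner H (fun z => B (A f) z - A (B f) z) f.

Definition cohyponormal (R : realType) (H : function_space R) (A : operator R) : Prop :=
  bounded_op H A /\ exists2 B, adjoint H A B & hyponormal H B.

Definition normal_op (R : realType) (H : function_space R) (A : operator R) : Prop :=
  bounded_op H A /\
  exists2 B, adjoint H A B &
    forall f, in_space H f -> forall z, disk z -> B (A f) z = A (B f) z.

Definition wcomp (R : realType) (psi phi : R[i] -> R[i]) : operator R :=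
  fun f z => psi z * f (phi z).

(* Main.v *)
Require Import Defs.
From mathcomp Require Import all_boot all_order all_algebra.
From mathcomp Require Import complex.
From mathcomp Require Import all_classical all_reals all_analysis.
From mathcomp Require Import measurable_realfun.
From mathcomp Require Import ring lra.

(** The constant function 1 is the kernel at 0.  Write A for the weighted
composition operator, B for its adjoint and b = phi 0.  Then A 1 = K_a, and
B 1 = K_b because <f, B 1> = <A f, 1> is, up to a constant, (A f)(0) = f(b).
Comparing the squared norms of A 1 and B 1 therefore compares K_a(a) with
K_b(b), that is (1 - |a|^2)^(-gamma) with (1 - |b|^2)^(-gamma), and both are
increasing in the modulus.  Hyponormality, cohyponormality and normality give
the three comparisons when they are tested on 1 alone
([hyponormal_kernel_le], [cohyponormal_kernel_le], [normal_kernel_eq]).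

The substance is the reproducing property [reproducing]: <f, K_b> = m_0 f(b)
with some m_0 > 0, a factor common to both sides of every comparison.  In
either space the squared norm of a function with Taylor coefficients c_n is the
sum of m_n |c_n|^2, where m_n = 1 in the Hardy space and m_n is the integral of
|z|^(2n) against the weight in the Bergman space.  The moments satisfy (n + 1)
m_n = (gamma + n) m_(n+1), so that m_n kappa_n = m_0 when kappa_n is the n-th
coefficient of (1 - x)^(-gamma). Since K_b has the coefficients kappa_n
conj(b)^n, the series of <f, K_b> is m_0 times the power series of f at b.  It
remains to justify four points.

- The binomial series converges to the principal power [cpow]
  ([binomial_series]).  The product of (1 - t u)^s and the N-th partial sum at
  t u has an explicit derivative in t, which is O(N kappa_N |u|^N).

- Distinct monomials are orthogonal on discs
  ([integral_monomial_orthogonal]), by invariance of area under rotations,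
  which are products of three shears.

- The recurrence of the moments ([moment_step]) comes from the divergence
  theorem on the discs |z|^2 <= rho for the field g(|z|^2) (x, y) with
  g(t) = t^n (1 - t)^(alpha + 1), whose flux vanishes as rho tends to 1.

- Parseval's identity ([parseval]) follows by dominated convergence on discs
  and monotone convergence as the discs exhaust the unit disk.  Applied to the
  zero function it also yields the uniqueness of Taylor coefficients
  ([expands_inj]), and polarization carries it over to inner products
  ([inner_cvg]). *)

Set Implicit Arguments.
Unset Strict Implicit.
Unset Printing Implicit Defensive.
Import Order.TTheory GRing.Theory Num.Theory.
Import numFieldNormedType.Exports.
Local Open Scope classical_set_scope.
Local Open Scope complex_scope.
Local Open Scope ring_scope.

Local Notation Re := complex.Re.
Local Notation Im := complex.Im.
Local Notation normc := Normc.normc.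

(** * Complex numbers in real coordinates *)

Section ComplexNumbers.
Variable R : realType.
Implicit Types z w : R[i].

Lemma cReD z w : Re (z + w) = Re z + Re w. Proof. by case: z; case: w. Qed.
Lemma cImD z w : Im (z + w) = Im z + Im w. Proof. by case: z; case: w. Qed.
Lemma cReB z w : Re (z - w) = Re z - Re w. Proof. by case: z; case: w. Qed.
Lemma cImB z w : Im (z - w) = Im z - Im w. Proof. by case: z; case: w. Qed.
Lemma cReM z w : Re (z * w) = Re z * Re w - Im z * Im w.
Proof. by case: z; case: w. Qed.
Lemma cImM z w : Im (z * w) = Re z * Im w + Im z * Re w.
Proof. by case: z; case: w. Qed.
Lemma cReJ z : Re z^* = Re z. Proof. by case: z. Qed.
Lemma cImJ z : Im z^* = - Im z. Proof. by case: z. Qed.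
Definition cReImE := (cReD, cImD, cReB, cImB, cReM, cImM, cReJ, cImJ).

Lemma Re_sum I (r : seq I) (P : pred I) (F : I -> R[i]) :
  Re (\sum_(i <- r | P i) F i) = \sum_(i <- r | P i) Re (F i).
Proof. exact: (big_morph _ cReD). Qed.

Lemma Im_sum I (r : seq I) (P : pred I) (F : I -> R[i]) :
  Im (\sum_(i <- r | P i) F i) = \sum_(i <- r | P i) Im (F i).
Proof. exact: (big_morph _ cImD). Qed.

Lemma complex_eqP z w : Re z = Re w -> Im z = Im w -> z = w.
Proof. by case: z; case: w => /= ? ? ? ? -> ->. Qed.

Lemma normc_sqr z : normc z ^+ 2 = Re z ^+ 2 + Im z ^+ 2.
Proof. by case: z => x y /=; rewrite sqr_sqrtr// addr_ge0// sqr_ge0. Qed.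

Lemma normr_normc z : `|z| = (normc z)%:C. Proof. by []. Qed.

Lemma normc_ge0 z : 0 <= normc z.
Proof. by rewrite -ler0c -normr_normc. Qed.

Lemma normcX z n : normc (z ^+ n) = normc z ^+ n.
Proof.
by elim: n => [|n ih]; rewrite ?expr0 ?Normc.normc1// !exprS Normc.normcM ih.
Qed.

Lemma cReN w : Re (- w) = - Re w. Proof. by case: w. Qed.
Lemma cImN w : Im (- w) = - Im w. Proof. by case: w. Qed.
Lemma cReZ (s : R) w : Re (s%:C * w) = s * Re w.
Proof. by rewrite cReM/= mul0r subr0. Qed.
Lemma cImZ (s : R) w : Im (s%:C * w) = s * Im w.
Proof. by rewrite cImM/= mul0r addr0. Qed.

Lemma cReV w : Re w^-1 = Re w / (Re w ^+ 2 + Im w ^+ 2). Proof. by case: w. Qed.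

Lemma cImV w : Im w^-1 = - Im w / (Re w ^+ 2 + Im w ^+ 2).
Proof. by case: w => x y /=; rewrite mulNr. Qed.

Lemma normcN w : normc (- w) = normc w.
Proof. by case: w => x y /=; rewrite !sqrrN. Qed.

Lemma normc_triangle w z : normc (w + z) <= normc w + normc z.
Proof. by have := ler_normD w z; rewrite !normr_normc -rmorphD lecR. Qed.

Lemma normc_real (x : R) : normc x%:C = `|x|.
Proof. by rewrite /= expr0n/= addr0 sqrtr_sqr. Qed.

Lemma normcJ (z : R[i]) : normc z^* = normc z.
Proof. by case: z => x y; rewrite /= sqrrN. Qed.

Lemma conj_mul_self (b : R[i]) : b^* * b = (normc b ^+ 2)%:C.
Proof. by rewrite normc_sqr; apply: complex_eqP; rewrite !cReImE/=; ring. Qed.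

Lemma disk_normc z : disk z <-> normc z < 1.
Proof. by rewrite /disk/= normr_normc -[1]/(1%:C) ltcR. Qed.

Lemma disk_sqr z : disk z <-> Re z ^+ 2 + Im z ^+ 2 < 1.
Proof. by rewrite disk_normc -normc_sqr expr_lt1// normc_ge0. Qed.

Lemma Re_le_normc z : `|Re z| <= normc z.
Proof.
rewrite -(@ler_pXn2r _ 2)// ?nnegrE ?normc_ge0// normc_sqr.
by rewrite real_normK ?num_real// lerDl sqr_ge0.
Qed.

Lemma Im_le_normc z : `|Im z| <= normc z.
Proof.
rewrite -(@ler_pXn2r _ 2)// ?nnegrE ?normc_ge0// normc_sqr.
by rewrite real_normK ?num_real// lerDr sqr_ge0.
Qed.

Lemma normc_le z : normc z <= `|Re z| + `|Im z|.
Proof.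
rewrite -(@ler_pXn2r _ 2)// ?nnegrE ?normc_ge0 ?addr_ge0// normc_sqr.
rewrite sqrrD !real_normK ?num_real// lerD2r lerDl.
by rewrite mulrn_wge0// mulr_ge0.
Qed.

(** Limits in [R[i]^o] are taken for a norm with values in [R[i]]; this reduces
them to limits of real sequences. *)
Lemma cvg_complexP (u : nat -> R[i]^o) (l : R[i]^o) :
  u @ \oo --> l <->
  ((fun n => Re (u n)) @ \oo --> Re l) /\ ((fun n => Im (u n)) @ \oo --> Im l).
Proof.
split.
- move/cvgrPdist_lt => h; split; apply/cvgrPdist_lt => e e0.
  + have e0' : 0 < e%:C :> R[i] by rewrite ltcR.
    have := h _ e0'; apply: filterS => n.
    rewrite normr_normc ltcR; apply: le_lt_trans.
    by rewrite -cReB Re_le_normc.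
  + have e0' : 0 < e%:C :> R[i] by rewrite ltcR.
    have := h _ e0'; apply: filterS => n.
    rewrite normr_normc ltcR; apply: le_lt_trans.
    by rewrite -cImB Im_le_normc.
- move=> [/cvgrPdist_lt h1 /cvgrPdist_lt h2]; apply/cvgrPdist_lt => e.
  rewrite ltcE/= => /andP[/eqP ei e0].
  have e2 : 0 < Re e / 2 by rewrite divr_gt0.
  move: (h1 _ e2) (h2 _ e2); apply: filterS2 => n b1 b2.
  have -> : e = (Re e)%:C by case: (e) ei => ? ? /= ->.
  rewrite normr_normc ltcR (le_lt_trans (normc_le _))//.
  by rewrite cReB cImB [ltRHS]splitr ltrD.
Qed.

End ComplexNumbers.

(** * The binomial series *)

Section BinomialSeries.
Variable R : realType.
Implicit Types (u w : R[i]) (s t : R).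

(** The derivative of a curve in the complex plane along the real line, kept in
coordinates so that the calculus of real functions applies. *)
Definition complex_derive (F : R -> R[i]) t (d : R[i]) :=
  is_derive t 1 (fun x => Re (F x)) (Re d) /\
  is_derive t 1 (fun x => Im (F x)) (Im d).

Lemma complex_derive_cst c t : complex_derive (fun=> c) t 0.
Proof. by split; apply: is_derive_cst. Qed.

Lemma complex_deriveD F G t d e : complex_derive F t d -> complex_derive G t e ->
  complex_derive (fun x => F x + G x) t (d + e).
Proof.
move=> [F1 F2] [G1 G2]; split.
- rewrite cReD (_ : (fun x => _) = (fun x => Re (F x)) + (fun x => Re (G x))).
    exact: is_deriveD.
  by apply/funext => x /=; rewrite cReD.
- rewrite cImD (_ : (fun x => _) = (fun x => Im (F x)) + (fun x => Im (G x))).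
    exact: is_deriveD.
  by apply/funext => x /=; rewrite cImD.
Qed.

Lemma complex_deriveM F G t d e : complex_derive F t d -> complex_derive G t e ->
  complex_derive (fun x => F x * G x) t (d * G t + F t * e).
Proof.
move=> [F1 F2] [G1 G2].
have hr := is_deriveB (is_deriveM F1 G1) (is_deriveM F2 G2).
have hi := is_deriveD (is_deriveM F1 G2) (is_deriveM F2 G1).
split.
- rewrite (_ : (fun x => _) = (fun x => Re (F x)) * (fun x => Re (G x)) -
    (fun x => Im (F x)) * (fun x => Im (G x))); last first.
    by apply/funext => x /=; rewrite cReM.
  by apply: (is_derive_eq hr); rewrite !cReImE /GRing.scale/=; ring.
- rewrite (_ : (fun x => _) = (fun x => Re (F x)) * (fun x => Im (G x)) +
    (fun x => Im (F x)) * (fun x => Re (G x))); last first.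
    by apply/funext => x /=; rewrite cImM.
  by apply: (is_derive_eq hi); rewrite !cReImE /GRing.scale/=; ring.
Qed.

Lemma complex_derive_line u t : complex_derive (fun x => x%:C * u) t u.
Proof.
split.
- rewrite (_ : (fun x => _) = (fun x => Re u * x)); last first.
    by apply/funext => x /=; rewrite cReM/= mul0r subr0 mulrC.
  by apply: is_derive_eq; rewrite /GRing.scale/= mulr1.
- rewrite (_ : (fun x => _) = (fun x => Im u * x)); last first.
    by apply/funext => x /=; rewrite cImM/= mul0r addr0 mulrC.
  by apply: is_derive_eq; rewrite /GRing.scale/= mulr1.
Qed.

Lemma complex_derive_lineX u n t :
  complex_derive (fun x => (x%:C * u) ^+ n) t (n%:R * (t%:C * u) ^+ n.-1 * u).
Proof.
elim: n => [|n ih].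
  rewrite !mul0r (_ : (fun x => _) = fun=> 1); first exact: complex_derive_cst.
  by apply/funext => x; rewrite expr0.
have := complex_deriveM (complex_derive_line u t) ih.
rewrite (_ : (fun x => _) = fun x => (x%:C * u) ^+ n.+1); last first.
  by apply/funext => x; rewrite exprS.
congr complex_derive => /=; case: n ih => [|n] ih /=.
  by rewrite !expr0; ring.
by rewrite exprS -[n.+2%:R]natr1; ring.
Qed.

Lemma normc_cpow w s : normc (cpow w s) = normc w `^ s.
Proof.
rewrite /cpow /= !exprMn -mulrDr cos2Dsin2 mulr1 sqrtr_sqr ger0_norm//.
exact: powR_ge0.
Qed.

Lemma cpowN w s : 0 < Re w -> cpow w (- s) * cpow w s = 1.
Proof.
move=> w0; have r0 : 0 < normc w.
  by rewrite (lt_le_trans w0)// (le_trans _ (Re_le_normc w)) ?ler_norm.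
have h : normc w `^ (- s) * normc w `^ s = 1.
  rewrite -powRD ?addNr ?powRr0//; apply/implyP => _; exact: lt0r_neq0.
have cs := cos2Dsin2 (s * atan (Im w / Re w)).
rewrite /cpow mulNr cosN sinN; apply: complex_eqP; rewrite ?cReM ?cImM /=.
- rewrite -[RHS]h -[RHS]mulr1 -cs; ring.
- ring.
Qed.

(** The next two lemmas are the real and the imaginary part of
(log w)' = w' / w for w = x + i y. *)
Lemma derive_ln_sqr (x y : R -> R) t dx dy : is_derive t 1 x dx ->
  is_derive t 1 y dy -> 0 < x t ->
  is_derive t 1 (fun r => ln (x r ^+ 2 + y r ^+ 2) / 2)
    ((x t * dx + y t * dy) / (x t ^+ 2 + y t ^+ 2)).
Proof.
move=> hx hy x0; have q0 : 0 < x t ^+ 2 + y t ^+ 2.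
  by rewrite ltr_pwDl ?exprn_gt0 ?sqr_ge0.
have h1 := is_deriveD (is_deriveM hx hx) (is_deriveM hy hy).
have h2 : is_derive ((x * x + y * y) t) 1 (@ln R) ((x t ^+ 2 + y t ^+ 2)^-1).
  exact: is_derive1_ln.
have h3 := is_deriveZ 2^-1 (is_derive1_comp h2 h1).
rewrite (_ : (fun r => _) = 2^-1 *: (@ln R \o (x * x + y * y))); last first.
  by apply/funext => r; rewrite /GRing.scale/= mulrC.
apply: (is_derive_eq h3); rewrite /GRing.scale/=; field.
by rewrite gt_eqF.
Qed.

Lemma derive_atan_div (x y : R -> R) t dx dy : is_derive t 1 x dx ->
  is_derive t 1 y dy -> 0 < x t ->
  is_derive t 1 (fun r => atan (y r / x r))
    ((x t * dy - y t * dx) / (x t ^+ 2 + y t ^+ 2)).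
Proof.
move=> hx hy x0; have q0 : 0 < x t ^+ 2 + y t ^+ 2.
  by rewrite ltr_pwDl ?exprn_gt0 ?sqr_ge0.
have xn0 : x t != 0 by rewrite gt_eqF.
have h0 : is_derive t 1 (fun r => (x r)^-1) (- (x t) ^- 2 *: dx).
  exact: is_deriveV.
have h1 : is_derive t 1 (y * (fun r => (x r)^-1)) ((x t * dy - y t * dx) / x t ^+ 2).
  apply: (is_derive_eq (is_deriveM hy h0)); rewrite /GRing.scale/=; field.
  by [].
have h2 : is_derive ((y * (fun r => (x r)^-1)) t) 1 (@atan R) ((1 + (y t / x t) ^+ 2)^-1).
  exact: is_derive1_atan.
have h3 := is_derive1_comp h2 h1.
rewrite (_ : (fun r => _) = @atan R \o (y * (fun r => (x r)^-1))) //.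
apply: (is_derive_eq h3); rewrite /GRing.scale/=; field.
by rewrite xn0 andbT gt_eqF.
Qed.

Lemma powR_normc w s : 0 < Re w ->
  normc w `^ s = expR (s * (ln (Re w ^+ 2 + Im w ^+ 2) / 2)).
Proof.
move=> w0; have r0 : 0 < normc w.
  by rewrite (lt_le_trans w0)// (le_trans _ (Re_le_normc w)) ?ler_norm.
rewrite /powR gt_eqF// -normc_sqr lnXn//; congr expR; congr (_ * _).
by rewrite -[X in X / 2]mulr_natr mulfK.
Qed.

Lemma complex_derive_cpow u s t : 0 < Re (1 - t%:C * u) ->
  complex_derive (fun x => cpow (1 - x%:C * u) s) t
    (- (s%:C * u) * cpow (1 - t%:C * u) s / (1 - t%:C * u)).
Proof.
set W := fun x : R => 1 - x%:C * u; rewrite -/(W t) => Wt.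
have [hx hy] : complex_derive W t (- u).
  have := complex_deriveD (complex_derive_cst 1 t) (complex_derive_line (- u) t).
  rewrite add0r; congr complex_derive; apply/funext => r.
  by rewrite /W mulrN.
have hL := derive_ln_sqr hx hy Wt.
have hA := derive_atan_div hx hy Wt.
have hE := is_derive1_comp (is_derive_expR _) (is_deriveZ s hL).
have hc := is_derive1_comp (is_derive_cos _) (is_deriveZ s hA).
have hs := is_derive1_comp (is_derive_sin _) (is_deriveZ s hA).
have nW : \near t, 0 < Re (W t).
  have /differentiable_continuous cx :
      differentiable (fun r : R => Re (W r)) t.
    exact/derivable1_diffP/(@ex_derive _ _ _ _ _ _ _ hx).
  exact: (cvgr_gt _ cx).
split.
- have hM := is_deriveM hE hc.
  apply: near_eq_is_derive (is_derive_eq hM _).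
    by apply: filterS nW => r Wr /=; rewrite powR_normc.
  rewrite /GRing.scale/=; move: (W t) Wt => w w0.
  have q0 : Re w ^+ 2 + Im w ^+ 2 != 0.
    by rewrite gt_eqF// ltr_pwDl ?exprn_gt0 ?sqr_ge0.
  rewrite !cReImE cReV cImV /cpow /= powR_normc// !cReN !cImN cReZ cImZ.
  by field.
- have hM := is_deriveM hE hs.
  apply: near_eq_is_derive (is_derive_eq hM _).
    by apply: filterS nW => r Wr /=; rewrite powR_normc.
  rewrite /GRing.scale/=; move: (W t) Wt => w w0.
  have q0 : Re w ^+ 2 + Im w ^+ 2 != 0.
    by rewrite gt_eqF// ltr_pwDl ?exprn_gt0 ?sqr_ge0.
  rewrite !cReImE cReV cImV /cpow /= powR_normc// !cReN !cImN cReZ cImZ.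
  by field.
Qed.

(** The coefficients of (1 - x)^(-s), that is s (s + 1) ... (s + n - 1) / n!. *)
Definition binomial_coef s n : R := \prod_(i < n) ((s + i%:R) / i.+1%:R).

Lemma binomial_coefS s n :
  n.+1%:R * binomial_coef s n.+1 = (s + n%:R) * binomial_coef s n.
Proof.
rewrite /binomial_coef big_ord_recr/= mulrC -mulrA divfK ?pnatr_eq0//.
by rewrite mulrC.
Qed.

Lemma binomial_coef_gt0 s n : 0 < s -> 0 < binomial_coef s n.
Proof.
by move=> s0; apply: prodr_gt0 => i _; rewrite divr_gt0// ltr_pwDl.
Qed.

Definition binomial_sum s n (x : R[i]) : R[i] :=
  \sum_(i < n) (binomial_coef s i)%:C * x ^+ i.

(** The derivative of [binomial_sum] as a polynomial. *)
Definition binomial_sum' s n (x : R[i]) : R[i] :=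
  \sum_(i < n) (binomial_coef s i)%:C * (i%:R * x ^+ i.-1).

(** The function (1 - x)^(-s) solves (1 - x) y' = s y; its partial sums solve the
equation up to a single term of the highest degree. *)
Lemma binomial_sum_ode s n x :
  (1 - x) * binomial_sum' s n x - s%:C * binomial_sum s n x =
  - ((n%:R * binomial_coef s n)%:C * x ^+ n.-1).
Proof.
rewrite /binomial_sum /binomial_sum'; elim: n => [|n ih].
  by rewrite !big_ord0 mul0r -[0%:C]/(0 : R[i]) !mulr0 mul0r subrr oppr0.
rewrite !big_ord_recr/= !mulrDr opprD addrACA ih binomial_coefS.
rewrite !rmorphM/= rmorphD/= rmorph_nat.
by case: n ih => [|n] ih/=; rewrite ?expr0 ?exprS; ring.
Qed.

Lemma complex_derive_binomial_sum s n u t :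
  complex_derive (fun x => binomial_sum s n (x%:C * u)) t
    (binomial_sum' s n (t%:C * u) * u).
Proof.
rewrite /binomial_sum /binomial_sum'; elim: n => [|n ih].
  rewrite big_ord0 mul0r (_ : (fun x => _) = fun=> 0); last first.
    by apply/funext => x; rewrite big_ord0.
  exact: complex_derive_cst.
have h := complex_deriveD ih (complex_deriveM
  (complex_derive_cst (binomial_coef s n)%:C t) (complex_derive_lineX u n t)).
rewrite mul0r add0r in h.
rewrite (_ : (fun x => _) = fun x =>
    \sum_(i < n) (binomial_coef s i)%:C * (x%:C * u) ^+ i +
    (binomial_coef s n)%:C * (x%:C * u) ^+ n); last first.
  by apply/funext => x; rewrite big_ord_recr.
by rewrite big_ord_recr/= mulrDl -[X in _ + X]mulrA.
Qed.

(** The mean value theorem fails for curves, but it holds for each coordinate,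
which is enough for an estimate. *)
Lemma complex_MVT F (dF : R -> R[i]) (M : R) :
  (forall t, 0 <= t <= 1 -> complex_derive F t (dF t)) ->
  (forall t, 0 <= t <= 1 -> normc (dF t) <= M) ->
  `|Re (F 1) - Re (F 0)| <= M /\ `|Im (F 1) - Im (F 0)| <= M.
Proof.
move=> hF hM.
have key (p : R[i] -> R) : (forall w, `|p w| <= normc w) ->
    (forall t, 0 <= t <= 1 -> is_derive t 1 (fun x => p (F x)) (p (dF t))) ->
    `|p (F 1) - p (F 0)| <= M.
  move=> pw pF.
  have [||c] := @MVT R (fun x => p (F x)) (fun x => p (dF x)) 0 1 ltr01.
  - move=> x; rewrite in_itv/= => /andP[x0 x1].
    by apply: pF; rewrite !ltW.
  - apply: derivable_within_continuous => x; rewrite in_itv/= => x01.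
    exact: (@ex_derive _ _ _ _ _ _ _ (pF _ x01)).
  rewrite in_itv/= => /andP[c0 c1] ->; rewrite subr0 mulr1.
  by rewrite (le_trans (pw _))// hM// !ltW.
split; apply: key => //.
- exact: Re_le_normc.
- by move=> t t01; have [] := hF t t01.
- exact: Im_le_normc.
- by move=> t t01; have [] := hF t t01.
Qed.

(** The ratio of consecutive terms is (s + n) rho / n, which tends to rho < 1;
beyond N it is at most the midpoint q of rho and 1. *)
Lemma binomial_coef_decay s (rho : R) : 0 < s -> 0 <= rho -> rho < 1 ->
  (fun n => n%:R * binomial_coef s n * rho ^+ n) @ \oo --> (0 : R).
Proof.
move=> s0 r0 r1; pose q := (1 + rho) / 2.
have q0 : 0 <= q by rewrite /q; lra.
have q1 : q < 1 by rewrite /q; lra.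
set a := fun n => _.
have a0 n : 0 <= a n.
  by rewrite /a !mulr_ge0// ?exprn_ge0// ltW// binomial_coef_gt0.
pose N := (Num.truncn (2 * s / (1 - rho))).+1.
have aS n : (N <= n)%N -> a n.+1 <= q * a n.
  move=> Nn; have hn : 2 * s / (1 - rho) <= n%:R.
    rewrite (le_trans (ltW (truncnS_gt _)))// ler_nat//.
  rewrite ler_pdivrMr ?subr_gt0// in hn.
  rewrite /a binomial_coefS exprS.
  have -> : q * (n%:R * binomial_coef s n * rho ^+ n) =
    (q * n%:R) * (binomial_coef s n * rho ^+ n) by ring.
  have -> : (s + n%:R) * binomial_coef s n * (rho * rho ^+ n) =
    ((s + n%:R) * rho) * (binomial_coef s n * rho ^+ n) by ring.
  apply: ler_wpM2r; first by rewrite mulr_ge0 ?exprn_ge0// ltW// binomial_coef_gt0.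
  rewrite /q; have := ler_piMr (ltW s0) (ltW r1); lra.
have aN k : a (k + N)%N <= q ^+ k * a N.
  elim: k => [|k ih]; first by rewrite mul1r.
  rewrite addSn (le_trans (aS _ (leq_addl _ _)))// exprS -mulrA.
  exact: ler_wpM2l.
rewrite -(cvg_shiftn N).
apply: (@squeeze_cvgr _ _ _ _ (fun=> 0) (fun k => q ^+ k * a N)).
- by apply: nearW => k; rewrite a0 aN.
- exact: cvg_cst.
- rewrite -[X in _ --> X](mul0r (a N)); apply: cvgM; last exact: cvg_cst.
  by apply: cvg_expr; rewrite ger0_norm.
Qed.

(** The function E n t = (1 - t u)^s S_n(t u), with S_n the partial sum, is 1 at
t = 0.  By [binomial_sum_ode] the derivatives of its factors cancel except for
the top term, so E n 1 tends to 1, and multiplying by (1 - u)^(-s) gives the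
limit of S_n(u). *)
Lemma binomial_series s u : 0 < s -> disk u ->
  (fun n => binomial_sum s n u : R[i]^o) @ \oo --> (cpow (1 - u) (- s) : R[i]^o).
Proof.
move=> s0 /disk_normc u1.
pose E n (t : R) := cpow (1 - t%:C * u) s * binomial_sum s n (t%:C * u).
pose W (t : R) := 1 - t%:C * u.
have tu t : 0 <= t <= 1 -> normc (t%:C * u) <= normc u.
  move=> /andP[t0 t1]; rewrite Normc.normcM normc_real ger0_norm//.
  by rewrite ler_piMl// normc_ge0.
have ReW t : 0 <= t <= 1 -> 0 < Re (W t).
  move=> t01; rewrite cReB/= subr_gt0 (le_lt_trans _ u1)//.
  by rewrite (le_trans _ (tu _ t01))// (le_trans _ (Re_le_normc _))// ler_norm.
have W0 t : 0 <= t <= 1 -> W t != 0.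
  by move=> /ReW; apply: contraTneq => ->; rewrite /= ltxx.
have nW t : 0 <= t <= 1 -> 1 - normc u <= normc (W t) <= 2.
  move=> t01; apply/andP; split.
    rewrite (le_trans _ (le_trans (ler_norm _) (Re_le_normc _)))// cReB/= lerD2l lerN2.
    by rewrite (le_trans _ (tu _ t01))// (le_trans _ (Re_le_normc _))// ler_norm.
  rewrite (le_trans (normc_triangle _ _))// normcN Normc.normc1.
  by rewrite -[leRHS]/(1 + 1) lerD2l (le_trans (tu _ t01))// ltW.
pose M n := 2 `^ s / (1 - normc u) * (n%:R * binomial_coef s n * normc u ^+ n).
have EM n : (0 < n)%N -> `|Re (E n 1) - 1| <= M n /\ `|Im (E n 1)| <= M n.
  move=> n0.
  have E0 : E n 0 = 1.
    rewrite /E [0%:C * u]mul0r subr0 /binomial_sum; case: n n0 => // n _.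
    rewrite big_ord_recl big1 ?addr0; last first.
      by move=> i _; rewrite expr0n mulr0.
    rewrite /binomial_coef big_ord0 expr0 !mulr1 /cpow/=.
    by rewrite mul0r atan0 mulr0 cos0 sin0 mulr0 expr0n addr0 expr1n sqrtr1 powR1 mul1r.
  pose dE (t : R) := - (cpow (W t) s * u / W t *
    ((n%:R * binomial_coef s n)%:C * (t%:C * u) ^+ n.-1)).
  have [||h1 h2] := @complex_MVT (E n) dE (M n).
  - move=> t t01.
    have := complex_deriveM (complex_derive_cpow s (ReW _ t01))
      (complex_derive_binomial_sum s n u t).
    congr complex_derive; rewrite -/(W t) /dE -[RHS]mulrN -binomial_sum_ode -/(W t).
    by field; exact: W0.
  - move=> t t01; rewrite /dE normcN !Normc.normcM Normc.normcV normc_cpow.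
    rewrite normc_real normcX ger0_norm; last first.
      by rewrite mulr_ge0// ltW// binomial_coef_gt0.
    have [nW1 nW2] := andP (nW _ t01).
    have u0 := normc_ge0 u.
    have W1 : normc (W t) `^ s <= 2 `^ s by rewrite ge0_ler_powR ?nnegrE ?normc_ge0// ltW.
    have W2 : (normc (W t))^-1 <= (1 - normc u)^-1.
      by rewrite lef_pV2 ?posrE// ?subr_gt0// (lt_le_trans _ nW1)// subr_gt0.
    have b0 : 0 <= n%:R * binomial_coef s n by rewrite mulr_ge0// ltW// binomial_coef_gt0.
    have -> : M n = 2 `^ s * normc u / (1 - normc u) *
        (n%:R * binomial_coef s n * normc u ^+ n.-1).
      have en : normc u ^+ n = normc u * normc u ^+ n.-1 by rewrite -exprS prednK.
      by rewrite /M en; ring.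
    have k0 := ltW (binomial_coef_gt0 n s0).
    apply: ler_pM; rewrite ?mulr_ge0 ?powR_ge0 ?invr_ge0 ?exprn_ge0 ?normc_ge0//.
      apply: ler_pM; rewrite ?mulr_ge0 ?powR_ge0 ?invr_ge0 ?normc_ge0//.
      exact: ler_wpM2r.
    by apply: ler_wpM2l => //; rewrite lerXn2r ?nnegrE ?normc_ge0// tu.
  by rewrite E0/= subr0 in h1 h2.
have M0 : M @ \oo --> (0 : R).
  rewrite -(mulr0 (2 `^ s / (1 - normc u))); apply: cvgM; first exact: cvg_cst.
  by apply: binomial_coef_decay => //; exact: normc_ge0.
have small (f : nat -> R) : (forall n, (0 < n)%N -> `|f n| <= M n) -> f @ \oo --> (0 : R).
  move=> fM; apply/norm_cvg0P.
  apply: (@squeeze_cvgr _ _ _ _ (fun=> 0) M) => //; last exact: cvg_cst.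
  by exists 1%N => // n /= n1; rewrite normr_ge0 fM.
have ReE : (fun n => Re (E n 1)) @ \oo --> (1 : R).
  apply/subr_cvg0; apply: small => n n0.
  exact: (EM n n0).1.
have ImE : (fun n => Im (E n 1)) @ \oo --> (0 : R).
  by apply: small => n n0; exact: (EM n n0).2.
have -> : (fun n => binomial_sum s n u) = fun n => cpow (1 - u) (- s) * E n 1.
  apply/funext => n; rewrite /E mul1r mulrA cpowN ?mul1r//.
  by have := ReW 1; rewrite /W mul1r; apply; rewrite ler01 lexx.
set c := cpow (1 - u) (- s); apply/cvg_complexP; split.
- have : (fun n => Re c * Re (E n 1) - Im c * Im (E n 1)) @ \oo --> Re c * 1 - Im c * 0.
    by apply: cvgB; apply: cvgM => //; exact: cvg_cst.
  by rewrite mulr1 mulr0 subr0; under eq_fun do rewrite -cReM.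
- have : (fun n => Re c * Im (E n 1) + Im c * Re (E n 1)) @ \oo --> Re c * 0 + Im c * 1.
    by apply: cvgD; apply: cvgM => //; exact: cvg_cst.
  by rewrite mulr1 mulr0 add0r; under eq_fun do rewrite -cImM.
Qed.
End BinomialSeries.

(** * Area-preserving maps of the plane *)

Section AreaPreserving.
Variable R : realType.
Local Notation mR := (measurableTypeR R).
Local Notation P := (mR * mR)%type.
Local Notation mu := (@lebesgue_measure R).

Lemma lebesgue_translation (c : R) (A : set mR) : measurable A ->
  mu ((fun x => x + c) @^-1` A) = mu A.
Proof.
move=> mA; rewrite -[LHS]/(pushforward mu (fun x : mR => x + c : mR) A).
apply/esym/lebesgue_measure_unique => //= [|_ _ [[a b] _ <-]].
  exact: measurable_funD.
rewrite /pushforward/=.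
have -> : (fun x => x + c) @^-1` `]a, b]%classic = `]a - c, b - c]%classic.
  by apply/seteqP; split => x /=; rewrite !in_itv/= ltrBlDr lerBrDr.
rewrite !lebesgue_measure_itv/= !lte_fin ltrD2r.
by case: ifP => // _; rewrite -!EFinD; congr EFin; ring.
Qed.

Definition area_preserving (T : P -> P) :=
  measurable_fun setT T /\
  forall A, measurable A -> @area R (T @^-1` A) = @area R A.

Lemma area_preserving_comp S T : area_preserving S -> area_preserving T ->
  area_preserving (S \o T).
Proof.
move=> [mS hS] [mT hT]; split; first exact: measurableT_comp.
move=> A mA; rewrite comp_preimage hT ?hS//.
by rewrite -[_ @^-1` _]setTI; exact: mS.
Qed.

(** Area as an integral over the second coordinate, for the shears that
move the first one. *)
Lemma area_product2 (A : set P) : measurable A -> @area R A = (mu \x^ mu)%E A.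
Proof.
apply: product_measure_unique => X Y mX mY.
exact: product_measure2E.
Qed.

(** A shear translates every section parallel to its direction. *)
Lemma area_preserving_shear2 (s : R) :
  area_preserving (fun p => (p.1, p.2 + s * p.1)).
Proof.
have mT : measurable_fun [set: P] (fun p : P => (p.1, p.2 + s * p.1) : P).
  apply/measurable_fun_pairP; split => /=; first exact: measurable_fst.
  apply: measurable_funD; first exact: measurable_snd.
  by apply: measurable_funM => //; exact: measurable_fst.
split=> [|A mA]; first exact: mT.
apply: eq_integral => x _ /=.
rewrite -(lebesgue_translation (s * x) (measurable_xsection _ mA)).
by congr (mu _); apply/seteqP; split => y; rewrite /xsection/= !inE.
Qed.

Lemma area_preserving_shear1 (s : R) :
  area_preserving (fun p => (p.1 + s * p.2, p.2)).
Proof.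
have mT : measurable_fun [set: P] (fun p : P => (p.1 + s * p.2, p.2) : P).
  apply/measurable_fun_pairP; split => /=; last exact: measurable_snd.
  apply: measurable_funD; first exact: measurable_fst.
  by apply: measurable_funM => //; exact: measurable_snd.
split=> [|A mA]; first exact: mT.
have mTA : measurable ((fun p : P => (p.1 + s * p.2, p.2) : P) @^-1` A).
  by rewrite -[_ @^-1` _]setTI; exact: mT.
rewrite (area_product2 mTA) (area_product2 mA).
apply: eq_integral => y _ /=.
rewrite -(lebesgue_translation (s * y) (measurable_ysection _ mA)).
by congr (mu _); apply/seteqP; split => x; rewrite /ysection/= !inE.
Qed.

Definition rotation (c s : R) (p : P) : P := (c * p.1 - s * p.2, s * p.1 + c * p.2).

(** A rotation that is not a multiple of a half turn is the product of a
horizontal, a vertical and again the same horizontal shear, with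
t = - tan (theta / 2) = (c - 1) / s. *)
Lemma area_preserving_rotation (c s : R) : c ^+ 2 + s ^+ 2 = 1 -> s != 0 ->
  area_preserving (rotation c s).
Proof.
move=> cs s0; pose t := (c - 1) / s.
have := area_preserving_comp (area_preserving_shear1 t)
  (area_preserving_comp (area_preserving_shear2 s) (area_preserving_shear1 t)).
congr area_preserving; apply/funext => -[x y]; rewrite /rotation /t/=.
have ss : s * s = (1 - c) * (1 + c) by rewrite -expr2; move: cs; lra.
congr pair; last by field.
by apply: (mulfI s0); field: ss.
Qed.

Lemma integral_area_preserving (T : P -> P) D (f : P -> \bar R) :
  area_preserving T -> measurable D ->
  measurable_fun setT f -> (@area R).-integrable (T @^-1` D) (f \o T) ->
  (\int[@area R]_(x in T @^-1` D) f (T x) = \int[@area R]_(y in D) f y)%E.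
Proof.
move=> hT mD mf If; rewrite -(integral_pushforward hT.1 mf If mD).
by apply: eq_measure_integral => [|mT A mA _]; [exact: hT.1|exact: hT.2].
Qed.

End AreaPreserving.

(** * The divergence theorem for radial fields *)

Section Divergence.
Variable R : realType.
Local Notation mR := (measurableTypeR R).
Local Notation P := (mR * mR)%type.
Local Notation mu := (@lebesgue_measure R).

Definition sqdist (p : P) : R := p.1 ^+ 2 + p.2 ^+ 2.
(** The parameter is the square of the radius, which is the natural variable for
the weight; the discs are closed so that their sections are compact intervals. *)
Definition cball (rho : R) : set P := [set p | sqdist p <= rho].

Lemma sqdist_ge0 p : 0 <= sqdist p.
Proof. by rewrite addr_ge0 ?sqr_ge0. Qed.

Lemma measurable_sqdist : measurable_fun [set: P] (sqdist : P -> R).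
Proof.
apply: measurable_funD; apply: measurable_funX.
  exact: measurable_fst.
exact: measurable_snd.
Qed.

Lemma measurable_cball rho : measurable (cball rho).
Proof.
have -> : cball rho = setT `&` sqdist @^-1` `]-oo, rho]%classic.
  by rewrite setTI; apply/seteqP; split => p /=; rewrite in_itv.
exact: measurable_sqdist.
Qed.

Lemma cball_sub_square rho : rho <= 1 ->
  cball rho `<=` `[-1, 1]%classic `*` `[-1, 1]%classic.
Proof.
move=> r1 [x y]; rewrite /cball/sqdist/= !in_itv/= => xy.
by split; apply/andP; split; nra.
Qed.

Lemma area_cball rho : rho <= 1 -> (@area R (cball rho) <= 4%:E)%E.
Proof.
move=> r1; have sq : @area R (`[-1, 1]%classic `*` `[-1, 1]%classic) = 4%:E.
  rewrite [LHS]product_measure1E//= !lebesgue_measure_itv/= lte_fin.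
  rewrite ifT; last lra.
  by rewrite -EFinB -EFinM; congr EFin; lra.
rewrite -sq; apply: le_measure; rewrite ?inE.
- exact: measurable_cball.
- exact: measurableX.
- exact: cball_sub_square.
Qed.

Lemma integrable_cball rho (f : P -> R) M : rho <= 1 ->
  measurable_fun (cball rho) f ->
  (forall p, cball rho p -> `|f p| <= M) ->
  (@area R).-integrable (cball rho) (EFin \o f).
Proof.
move=> r1 mf fM; apply: measurable_bounded_integrable => //.
- exact: measurable_cball.
- by rewrite (le_lt_trans (area_cball r1))// ltry.
- exists M; split; first exact: num_real.
  by move=> x Mx p /fM pM; rewrite /= (le_trans pM)// ltW.
Qed.

Lemma is_derive_continuous (f : R -> R) (x d : R) :
  is_derive x 1 f d -> {for x, continuous f}.
Proof.
move=> hf; apply/differentiable_continuous/derivable1_diffP.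
exact: (@ex_derive _ _ _ _ _ _ _ hf).
Qed.

Section RadialField.
Variables (rho M : R) (g g' : R -> R).
Hypothesis rho01 : 0 <= rho <= 1.
Hypothesis mg : measurable_fun setT g.
Hypothesis mg' : measurable_fun setT g'.
Hypothesis dg : forall t, 0 <= t <= rho -> is_derive t 1 g (g' t).
Hypothesis cg' : forall t, 0 <= t <= rho -> {for t, continuous g'}.
Hypothesis gM : forall t, 0 <= t <= rho -> `|g t| <= M /\ `|g' t| <= M.
Hypothesis grho : 0 <= g rho.

(* The partial derivative in y of y g(x^2 + y^2). *)
Let h (p : P) : R := g (sqdist p) + 2 * p.2 ^+ 2 * g' (sqdist p).

(** The fundamental theorem of calculus for y g(x^2 + y^2) on the section of the
disc at x, at whose two ends x^2 + y^2 = rho. *)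
Lemma integral_slice x : x ^+ 2 <= rho -> let s := Num.sqrt (rho - x ^+ 2) in
  (\int[mu]_(y in `[(- s)%R, s]) (h (x, y))%:E)%E = (2 * s * g rho)%:E.
Proof.
move=> xrho s; have s0 : 0 <= s by rewrite sqrtr_ge0.
have s2 : s ^+ 2 = rho - x ^+ 2 by rewrite sqr_sqrtr// subr_ge0.
have [s_eq0|s_neq0] := eqVneq s 0.
  by rewrite s_eq0 oppr0 set_itv1 integral_set1 mulr0 mul0r.
have s_gt0 : 0 < s by rewrite lt_neqAle eq_sym s_neq0.
have inb y : - s <= y <= s -> 0 <= x ^+ 2 + y ^+ 2 <= rho.
  move=> ys; rewrite addr_ge0 ?sqr_ge0//= -lerBrDl -s2.
  by move/andP: ys => [y1 y2]; nra.
pose q (y : R) : R := x ^+ 2 + y ^+ 2.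
have did (y : R) : is_derive y 1 (id : R -> R) 1 by exact: is_derive_id.
have dcst (y : R) : is_derive y 1 (fun=> x ^+ 2 : R) 0 by exact: is_derive_cst.
have dq (y : R) : is_derive y 1 q (2 * y).
  have hq := is_deriveD (dcst y) (is_deriveM (did y) (did y)).
  by apply: (is_derive_eq hq); rewrite /GRing.scale/=; ring.
have dF (y : R) : - s <= y <= s -> is_derive y 1 (fun y : R => y * g (q y)) (h (x, y)).
  move=> ys; have hg := @is_derive1_comp _ g q y _ _ (dg (inb y ys)) (dq y).
  have hF := is_deriveM (did y) hg.
  by apply: (is_derive_eq hF); rewrite /h /sqdist /GRing.scale/=; ring.
have cF (y : R) : - s <= y <= s -> {for y, continuous (fun y : R => y * g (q y))}.
  by move=> ys; exact: is_derive_continuous (dF y ys).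
rewrite (@continuous_FTC2 _ _ (fun y : R => y * g (q y))).
- rewrite -EFinB /q sqrrN s2 subrKC; congr EFin; ring.
- by rewrite gtrN.
- apply: continuous_in_subspaceT => y; rewrite inE/= in_itv/= => ys.
  have cq : {for y, continuous q} by exact: is_derive_continuous (dq y).
  have cgq : {for y, continuous (g \o q)}.
    apply: continuous_comp => //.
    exact: is_derive_continuous (dg (inb y ys)).
  have cgq' : {for y, continuous (g' \o q)}.
    by apply: continuous_comp => //; exact: (cg' (inb y ys)).
  have c2 : {for y, continuous (fun y : R => 2 * y ^+ 2)}.
    apply: (@is_derive_continuous _ _ (2 * (2 * y))).
    have h2 := is_deriveZ 2 (is_deriveM (did y) (did y)).
    by apply: (is_derive_eq h2); rewrite /GRing.scale/=; ring.
  exact: (continuousD cgq (continuousM c2 cgq')).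
- split.
  + move=> y; rewrite in_itv/= => /andP[y1 y2].
    by apply: (@ex_derive _ _ _ _ _ _ _ (dF y _)); rewrite !ltW.
  + by apply: cvg_at_right_filter; apply: cF; apply/andP; split; lra.
  + by apply: cvg_at_left_filter; apply: cF; apply/andP; split; lra.
- move=> y; rewrite in_itv/= => /andP[y1 y2].
  have hy : - s <= y <= s by rewrite !ltW.
  by rewrite derive1E (@derive_val _ _ _ _ _ _ _ (dF y hy)).
Qed.

Lemma measurable_radial_field (e : P -> R) : measurable_fun setT e ->
  measurable_fun setT (fun p => g (sqdist p) + 2 * e p ^+ 2 * g' (sqdist p)).
Proof.
move=> me.
apply: measurable_funD; first exact: measurableT_comp mg measurable_sqdist.
apply: measurable_funM; last exact: measurableT_comp mg' measurable_sqdist.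
by apply: measurable_funM => //; exact: measurable_funX.
Qed.

Lemma integrable_radial_field (e : P -> R) : measurable_fun setT e ->
  (forall p, e p ^+ 2 <= sqdist p) -> (@area R).-integrable (cball rho)
    (fun p => (g (sqdist p) + 2 * e p ^+ 2 * g' (sqdist p))%:E).
Proof.
move=> me e_le; have [r0 r1] := andP rho01.
apply: (@integrable_cball _ _ (M + 2 * M)) => //.
  exact: measurable_funS (measurable_radial_field me).
move=> p pr; have /gM[g1 g2] : 0 <= sqdist p <= rho by rewrite sqdist_ge0.
have p1 : `|e p ^+ 2| <= 1.
  by rewrite ger0_norm ?sqr_ge0// (le_trans (e_le p))// (le_trans pr r1).
rewrite /= (le_trans (ler_normD _ _))// lerD// (normrM (2 * e p ^+ 2)).
rewrite (normrM 2) ger0_norm// -mulrA.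
by rewrite ler_wpM2l// -[leRHS]mul1r ler_pM.
Qed.

(** Integrating [integral_slice] over x gives g(rho) times the area of the disc;
only the bound 4 on that area is recorded.  The other half of the divergence is
the same integral after a quarter turn. *)
Lemma integral_radial_field :
  (0 <= \int[@area R]_(p in cball rho) (h p)%:E <= (4 * g rho)%R%:E)%E.
Proof.
have [r0 r1] := andP rho01.
have mc := measurable_cball rho.
have Ih : (@area R).-integrable setT ((EFin \o h) \_ (cball rho)).
  apply/(integrable_mkcond _ mc)/integrable_radial_field.
    exact: measurable_snd.
  by move=> p; rewrite lerDr sqr_ge0.
rewrite integral_mkcond -[X in (_ <= X <= _)%E](integral12_prod_meas1 Ih).
have FE x : fubini_F mu ((EFin \o h) \_ (cball rho)) x =
  (2 * Num.sqrt (rho - x ^+ 2) * g rho * \1_[set x | x ^+ 2 <= rho] x)%:E.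
  rewrite /fubini_F indicE; case: (leP (x ^+ 2) rho) => xr; last first.
    rewrite memNset/= ?mulr0; last by rewrite leNgt xr.
    apply: integral0_eq => y _; rewrite patchE memNset// /cball/sqdist/= => h1.
    by move: xr; rewrite ltNge (le_trans _ h1)// lerDl sqr_ge0.
  rewrite mem_set//= mulr1 -integral_slice// [RHS]integral_mkcond.
  apply: eq_integral => y _; rewrite !patchE.
  have -> // : (y \in `[- Num.sqrt (rho - x ^+ 2), Num.sqrt (rho - x ^+ 2)]%classic) =
    ((x, y) \in cball rho).
  apply/idP/idP; rewrite !inE/= in_itv/= /cball/sqdist/=.
    move=> /andP[y1 y2]; rewrite -lerBrDl -[leRHS]sqr_sqrtr ?subr_ge0//.
    have := sqrtr_ge0 (rho - x ^+ 2); nra.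
  rewrite -ler_norml -sqrtr_sqr => h1; apply: ler_wsqrtr.
  by rewrite lerBrDl.
apply/andP; split.
  apply: integral_ge0 => x _; rewrite FE lee_fin !mulr_ge0 ?sqrtr_ge0//.
(* Sections are empty for x outside J, and have half-length at most 1. *)
pose J : set mR := `[-1, 1]%classic.
have mJ : measurable J by exact: measurable_itv.
have mI : measurable_fun setT (\1_J : _ -> R) by exact: measurable_indic.
apply: (@le_trans _ _ (\int[mu]_x ((2 * g rho)%:E * (\1_J x)%:E))%E).
  apply: ge0_le_integral => //.
  - by move=> x _; rewrite FE lee_fin !mulr_ge0 ?sqrtr_ge0//.
  - exact: measurable_fubini_F Ih.
  - by apply: measurable_funeM; apply/measurable_EFinP; exact: mI.
  - move=> x _; rewrite FE -EFinM lee_fin !indicE.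
    have [xr|xr] := leP (x ^+ 2) rho; last first.
      have -> : (x \in [set x | x ^+ 2 <= rho]) = false.
        by apply: memNset => /=; rewrite leNgt xr.
      by rewrite mulr0 !mulr_ge0.
    have x1 : x ^+ 2 <= 1 by exact: le_trans r1.
    have Jx : J x by rewrite /J/= in_itv/=; apply/andP; split; nra.
    rewrite (mem_set Jx) mem_set//=.
    rewrite !mulr1 ler_wpM2r// -[leRHS]mulr1 ler_wpM2l//.
    rewrite -[leRHS]sqrtr1; apply: ler_wsqrtr.
    by have := sqr_ge0 x; lra.
rewrite ge0_integralZl//; last 2 first.
  by apply/measurable_EFinP; exact: mI.
  by rewrite lee_fin mulr_ge0.
have muJ : mu J = 2%:E.
  rewrite /J lebesgue_measure_itv/= lte_fin ifT; last lra.
  by rewrite -EFinB; congr EFin; lra.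
rewrite integral_indic// setIT; change ((2 * g rho)%:E * mu J <= (4 * g rho)%:E)%E.
by rewrite muJ -EFinM lee_fin; nra.
Qed.

End RadialField.

End Divergence.

(** * Moments of the Bergman weight *)

Section Moments.
Variable R : realType.
Local Notation mR := (measurableTypeR R).
Local Notation P := (mR * mR)%type.
Local Notation mu := (@lebesgue_measure R).
Variable alpha : R.
Hypothesis alpha1 : -1 < alpha.

Let K := pi^-1 * (alpha + 1) : R.
Let K_gt0 : 0 < K.
Proof. by rewrite mulr_gt0 ?invr_gt0 ?pi_gt0// -ltrBlDr sub0r. Qed.

Definition radial_weight (t : R) : R := pi^-1 * (alpha + 1) * (1 - t) `^ alpha.

Lemma weight_pt p : weight alpha (pt p) = radial_weight (sqdist p).
Proof. by rewrite /weight normc_sqr. Qed.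

Lemma radial_weight_ge0 t : 0 <= radial_weight t.
Proof. by rewrite mulr_ge0 ?powR_ge0// ltW. Qed.

Lemma powR_succ t : t < 1 -> (1 - t) `^ (alpha + 1) = (1 - t) `^ alpha * (1 - t).
Proof.
move=> t1; rewrite powRD ?powRr1// ?subr_ge0 ?ltW//.
by apply/implyP => _; rewrite subr_eq0 eq_sym lt_eqF.
Qed.

Lemma powR_succ_le1 t : 0 <= t <= 1 -> (1 - t) `^ (alpha + 1) <= 1.
Proof.
move=> /andP[t0 t1]; rewrite [leRHS](_ : _ = 1 `^ (alpha + 1)); last by rewrite powR1.
by have a1 := alpha1; apply: ge0_ler_powR; rewrite ?nnegrE; lra.
Qed.

(** The weight is unbounded near the unit circle when alpha < 0; on a smaller disc
it is bounded uniformly in the sign of alpha. *)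
Lemma powR_le_inv rho t : 0 <= t <= rho -> rho < 1 -> (1 - t) `^ alpha <= (1 - rho)^-1.
Proof.
move=> /andP[t0 tr] r1; have t1 : t < 1 by exact: le_lt_trans r1.
have -> : (1 - t) `^ alpha = (1 - t) `^ (alpha + 1) * (1 - t)^-1.
  by rewrite powR_succ// mulfK// subr_eq0 eq_sym lt_eqF.
rewrite -[leRHS]mul1r ler_pM ?powR_ge0 ?invr_ge0//; first by lra.
- by apply: powR_succ_le1; lra.
- by rewrite lef_pV2 ?posrE; lra.
Qed.

Lemma derive_powR (s t : R) : t < 1 ->
  is_derive t 1 (fun x => (1 - x) `^ s) (- (s * (1 - t) `^ (s - 1))).
Proof.
move=> t1; have h : is_derive t 1 (fun x : R => 1 - x) (- 1).
  have h1 : is_derive t 1 (fun=> 1 : R) 0 by exact: is_derive_cst.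
  have h2 : is_derive t 1 (id : R -> R) 1 by exact: is_derive_id.
  by apply: (is_derive_eq (is_deriveB h1 h2)); rewrite sub0r.
have t1' : 0 < 1 - t by rewrite subr_gt0.
have hp := @is_derive1_comp _ (fun x : R => x `^ s) (fun x : R => 1 - x) t _ _
  (is_derive1_powR s t1') h.
by apply: (is_derive_eq hp); rewrite mulrN1.
Qed.

(* With this radial profile the divergence 2 (g + t g') is a combination of
   two consecutive moment densities, and g vanishes at t = 1 because
   alpha + 1 > 0. *)
Let g n (t : R) : R := K * (t ^+ n * (1 - t) `^ (alpha + 1)).
Let g' n (t : R) : R := K * (n%:R * t ^+ n.-1 * (1 - t) `^ (alpha + 1) -
  (alpha + 1) * t ^+ n * (1 - t) `^ alpha).

Let dg n (t : R) : t < 1 -> is_derive t 1 (g n) (g' n t).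
Proof.
move=> t1; have hX : is_derive t 1 (fun x : R => x ^+ n) (n%:R * t ^+ n.-1).
  have h2 : is_derive t 1 (id : R -> R) 1 by exact: is_derive_id.
  have hX := is_deriveX n h2; rewrite (_ : (fun x => _) = id ^+ n).
    by apply: (is_derive_eq hX); rewrite /GRing.scale/= mulr1.
  by apply/funext => x; rewrite exprfctE.
have h := is_deriveZ K (is_deriveM hX (derive_powR (alpha + 1) t1)).
apply: (is_derive_eq h); rewrite addrK /g' /GRing.scale/=; ring.
Qed.

Let measurable_powR1 s : measurable_fun setT (fun t : R => (1 - t) `^ s).
Proof.
apply: (measurableT_comp (measurable_powR s)).
exact: measurable_funB.
Qed.

Let measurable_g n : measurable_fun setT (g n).
Proof. by apply: measurable_funM => //; apply: measurable_funM. Qed.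

Let measurable_g' n : measurable_fun setT (g' n).
Proof.
apply: measurable_funM => //; apply: measurable_funB; apply: measurable_funM => //.
  by apply: measurable_funM.
by apply: measurable_funM.
Qed.

Let continuous_g' n (t : R) : t < 1 -> {for t, continuous (g' n)}.
Proof.
move=> t1.
have c1 := is_derive_continuous (derive_powR (alpha + 1) t1).
have c2 := is_derive_continuous (derive_powR alpha t1).
have cX m : {for t, continuous (fun x : R => x ^+ m)} by exact: exprn_continuous.
have cc (c : R) : {for t, continuous (fun=> c : R)} by exact: cst_continuous.
exact: (continuousM (cc K) (continuousB (continuousM (continuousM (cc n%:R) (cX n.-1)) c1)
   (continuousM (continuousM (cc (alpha + 1)) (cX n)) c2))).
Qed.

Definition moment_upto rho n : R :=
  \int[@area R]_(p in cball rho) (sqdist p ^+ n * radial_weight (sqdist p)).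

Lemma measurable_radial_weight : measurable_fun setT radial_weight.
Proof. exact: measurable_funM. Qed.

Lemma measurable_moment n :
  measurable_fun setT (fun p : P => sqdist p ^+ n * radial_weight (sqdist p)).
Proof.
have ms := @measurable_sqdist R.
apply: measurable_funM; first exact: measurable_funX.
exact: measurableT_comp measurable_radial_weight ms.
Qed.

Lemma integrable_moment_upto rho n : rho < 1 -> (@area R).-integrable (cball rho)
  (fun p => (sqdist p ^+ n * radial_weight (sqdist p))%:E).
Proof.
move=> r1; apply: (@integrable_cball _ _ _ (K * (1 - rho)^-1)); first exact: ltW.
  exact: measurable_funS (measurable_moment n).
move=> p pr; have s0 := sqdist_ge0 p.
have p01 : 0 <= sqdist p <= rho by rewrite s0.
rewrite ger0_norm; last by rewrite mulr_ge0 ?exprn_ge0 ?radial_weight_ge0.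
rewrite -[leRHS]mul1r ler_pM ?exprn_ge0 ?radial_weight_ge0//.
  by rewrite exprn_ile1// (le_trans _ (ltW r1)).
by rewrite ler_wpM2l ?powR_le_inv// ltW.
Qed.

(** Half the divergence of the field g(|z|^2) (x, y) is the density of
(n + 1) m_n - (n + alpha + 2) m_(n+1), and its integral is half the flux. *)
Lemma moment_upto_step rho n : 0 <= rho < 1 ->
  0 <= n.+1%:R * moment_upto rho n - (n%:R + alpha + 2) * moment_upto rho n.+1
    <= 4 * K * (1 - rho) `^ (alpha + 1).
Proof.
move=> /andP[r0 r1].
have rho01 : 0 <= rho <= 1 by rewrite r0 ltW.
pose M := K * (1 + n%:R + (alpha + 1) * (1 - rho)^-1).
have lt1 (t : R) : 0 <= t <= rho -> t < 1 by move=> /andP[_ tr]; exact: le_lt_trans r1.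
have gM (t : R) : 0 <= t <= rho -> `|g n t| <= M /\ `|g' n t| <= M.
  move=> tr; have /andP[t0 t_rho] := tr; have t1 := lt1 t tr.
  have t01 : 0 <= t <= 1 by rewrite t0 ltW.
  have ap : 0 <= alpha + 1 by rewrite -lerBlDr sub0r ltW.
  have X1 m : `|t ^+ m| <= 1 by rewrite ger0_norm ?exprn_ge0 ?exprn_ile1// ltW.
  have P1 : `|(1 - t) `^ (alpha + 1)| <= 1 by rewrite ger0_norm ?powR_ge0 ?powR_succ_le1.
  have P2 : `|(1 - t) `^ alpha| <= (1 - rho)^-1.
    by rewrite ger0_norm ?powR_ge0 ?powR_le_inv.
  have inv0 : 0 <= (1 - rho)^-1 by rewrite invr_ge0 subr_ge0 ltW.
  have K0 := ltW K_gt0.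
  split; rewrite /g /g' /M normrM (ger0_norm K0) ler_wpM2l//.
    rewrite normrM -[leLHS]mulr1 (@le_trans _ _ 1) ?mulr1 ?ler_piMr//.
      by rewrite -[leRHS]mulr1 ler_pM.
    by rewrite -addrA lerDl addr_ge0// mulr_ge0.
  rewrite (le_trans (ler_normB _ _))// lerD//; rewrite !normrM.
    rewrite ger0_norm// -mulrA -[leRHS]mulr1 (@le_trans _ _ n%:R) ?mulr1 ?lerDr//.
    by rewrite -[leRHS]mulr1 ler_wpM2l// -[leRHS]mulr1 ler_pM.
  rewrite (ger0_norm ap) -mulrA ler_wpM2l// -[leRHS]mul1r; exact: ler_pM.
have grho : 0 <= g n rho.
  by rewrite mulr_ge0 ?(ltW K_gt0)// mulr_ge0 ?exprn_ge0 ?powR_ge0.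
have dg0 (t : R) (tr : 0 <= t <= rho) := @dg n t (lt1 t tr).
have cg0 (t : R) (tr : 0 <= t <= rho) := @continuous_g' n t (lt1 t tr).
have mgn := @measurable_g n; have mgn' := @measurable_g' n.
have I2 := integral_radial_field rho01 mgn mgn' dg0 cg0 gM grho.
have Int e me := @integrable_radial_field _ _ _ _ _ rho01 mgn mgn' gM e me.
have mfst : measurable_fun setT (fst : P -> R) by exact: measurable_fst.
have msnd : measurable_fun setT (snd : P -> R) by exact: measurable_snd.
(* The two parts of the divergence, exchanged by the quarter turn. *)
set h2 := fun p : P => g n (sqdist p) + 2 * p.2 ^+ 2 * g' n (sqdist p).
pose h1 := fun p : P => g n (sqdist p) + 2 * p.1 ^+ 2 * g' n (sqdist p).
have quarter : area_preserving (@rotation R 0 1).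
  by apply: area_preserving_rotation; [rewrite expr0n expr1n add0r|exact: oner_neq0].
have sqrot p : sqdist (rotation 0 1 p) = sqdist p.
  by rewrite /sqdist /rotation/=; ring.
have rotball : rotation 0 1 @^-1` cball rho = cball rho.
  by apply/seteqP; split => p; rewrite /cball/= sqrot.
have hrot p : h2 (rotation 0 1 p) = h1 p.
  by rewrite /h2 sqrot /h1 /rotation/=; congr (_ + _ * _ * _); ring.
have mb := @measurable_cball R rho.
have Int1 : (@area R).-integrable (cball rho) (EFin \o h1).
  by apply: (Int fst) => // p; rewrite lerDl sqr_ge0.
have Int2 : (@area R).-integrable (cball rho) (EFin \o h2).
  by apply: (Int snd) => // p; rewrite lerDr sqr_ge0.
have I12 : (\int[@area R]_(p in cball rho) (h1 p)%:E =
    \int[@area R]_(p in cball rho) (h2 p)%:E)%E.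
  rewrite -(integral_area_preserving quarter mb (f := EFin \o h2)).
  - by rewrite rotball; apply: eq_integral => p _ /=; rewrite hrot.
  - by apply/measurable_EFinP; exact: (measurable_radial_field mgn mgn' msnd).
  - by rewrite rotball; apply: eq_integrable Int1 => // p _ /=; rewrite hrot.
have Rsum : \int[@area R]_(p in cball rho) (h1 p + h2 p) =
  2 * (n.+1%:R * moment_upto rho n - (n%:R + alpha + 2) * moment_upto rho n.+1).
  rewrite /moment_upto -RintegralZl//; last exact: integrable_moment_upto.
  rewrite -RintegralZl//; last exact: integrable_moment_upto.
  rewrite -RintegralB//; last 2 first.
  - exact: (integrableZl mb _ (integrable_moment_upto _ r1)).
  - exact: (integrableZl mb _ (integrable_moment_upto _ r1)).
  rewrite -RintegralZl//; last first.
    exact: (integrableB mb (integrableZl mb _ (integrable_moment_upto n r1))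
      (integrableZl mb _ (integrable_moment_upto n.+1 r1))).
  apply: eq_Rintegral => p; rewrite inE/= => pr.
  have q1 : sqdist p < 1 by exact: le_lt_trans r1.
  rewrite /h1 /h2 /g /g' /radial_weight -/K powR_succ//.
  have -> : p.2 ^+ 2 = sqdist p - p.1 ^+ 2 by rewrite /sqdist; ring.
  have nX : n%:R * sqdist p ^+ n.-1 * sqdist p = n%:R * sqdist p ^+ n.
    by case: (n) => [|m]; rewrite ?mul0r//= -mulrA -exprSr.
  rewrite !exprS -natr1.
  ring: nX.
have R12 : \int[@area R]_(p in cball rho) (h1 p + h2 p) =
    2 * \int[@area R]_(p in cball rho) h2 p.
  by rewrite RintegralD// {1}/Rintegral I12 mulr2n mulrDl mul1r.
have E2 : (\int[@area R]_(p in cball rho) (h2 p)%:E)%E =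
    (\int[@area R]_(p in cball rho) h2 p)%:E.
  by rewrite fineK//; exact: integrable_fin_num.
have two : (2 : R) != 0 by rewrite pnatr_eq0.
rewrite -[X in 0 <= X <= _](mulfI two (etrans (esym R12) Rsum)).
move: I2; rewrite E2 !lee_fin => /andP[-> /le_trans] /=; apply.
rewrite -mulrA ler_wpM2l// ler_wpM2l ?(ltW K_gt0)//.
by rewrite ler_piMl ?powR_ge0// exprn_ile1// ltW.
Qed.

Lemma moment_upto_ge0 rho n : 0 <= moment_upto rho n.
Proof.
by apply: Rintegral_ge0 => p _; rewrite mulr_ge0 ?exprn_ge0 ?sqdist_ge0 ?radial_weight_ge0.
Qed.

(** For n = 0 the recurrence bounds m_1 by m_0 / (alpha + 2), with
alpha + 2 > 1, while m_0 - m_1 is the integral of the bounded function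
(1 - t)^(alpha + 1).  Together they bound m_0 although the weight itself may be
unbounded. *)
Lemma moment_upto_bounded rho : 0 <= rho < 1 ->
  moment_upto rho 0 <= 4 * K * (alpha + 2) / (alpha + 1).
Proof.
move=> r01; have /andP[r0 r1] := r01; have mb := @measurable_cball R rho.
have /andP[+ _] := moment_upto_step 0 r01.
rewrite mul1r add0r => h1.
have h2 : moment_upto rho 0 - moment_upto rho 1 <= 4 * K.
  rewrite /moment_upto -RintegralB//; try exact: integrable_moment_upto.
  apply: (@le_trans _ _ (\int[@area R]_(p in cball rho) K)).
    apply: le_Rintegral => //.
    - exact: (integrableB mb (integrable_moment_upto 0 r1) (integrable_moment_upto 1 r1)).
    - apply: (@integrable_cball _ _ _ `|K|) => //; exact: ltW.
    - move=> p pr; have q1 : sqdist p < 1 by exact: le_lt_trans r1.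
      rewrite expr0 expr1 -mulrBl mulrC /radial_weight -/K -mulrA -powR_succ//.
      by rewrite ler_piMr ?(ltW K_gt0)// powR_succ_le1// sqdist_ge0 ltW.
  rewrite Rintegral_cst// mulrC ler_wpM2r ?(ltW K_gt0)//.
  have := area_cball (ltW r1) => h.
  rewrite -lee_fin fineK// ge0_fin_numE//.
  exact: le_lt_trans h (ltry _).
have a1 : 0 < alpha + 1 by rewrite -ltrBlDr sub0r.
rewrite ler_pdivlMr//.
have := moment_upto_ge0 rho 0; have := moment_upto_ge0 rho 1; nra.
Qed.

Definition exhaust (k : nat) : R := 1 - k.+1%:R^-1.

Lemma exhaust01 k : 0 <= exhaust k < 1.
Proof.
rewrite /exhaust subr_ge0 invf_le1 ?ltr0n// ler1n/= ltrBlDr ltrDl.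
by rewrite invr_gt0 ltr0n.
Qed.

Lemma cball_exhaust_nd : nondecreasing_seq (fun k => cball (exhaust k) : set P).
Proof.
move=> m n mn; apply/subsetPset => p /= h; apply: (le_trans h).
by rewrite lerD2l lerN2 lef_pV2 ?posrE ?ltr0n// ler_nat.
Qed.

Lemma cball_exhaust_bigcup :
  [set p : P | disk (pt p)] = \bigcup_k cball (exhaust k).
Proof.
apply/seteqP; split => p /=.
  move=> /disk_sqr; rewrite -[_ + _]/(sqdist p) => p1.
  have e0 : 0 < 1 - sqdist p by rewrite subr_gt0.
  exists (Num.truncn (1 - sqdist p)^-1) => //.
  rewrite /cball/= /exhaust lerBrDr addrC -lerBrDr.
  rewrite invf_ple ?posrE ?ltr0n//.
  exact/ltW/truncnS_gt.
move=> [k _ pk]; apply/disk_sqr; rewrite -[_ + _]/(sqdist p).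
by have /andP[_] := exhaust01 k; apply: le_lt_trans.
Qed.

End Moments.

Section DiskMoments.
Variable R : realType.
Local Notation mR := (measurableTypeR R).
Local Notation P := (mR * mR)%type.
Local Notation mu := (@lebesgue_measure R).

Definition unit_disk : set P := [set p | disk (pt p)].

Lemma measurable_unit_disk : measurable unit_disk.
Proof.
rewrite /unit_disk cball_exhaust_bigcup; apply: bigcup_measurable => k _.
exact: measurable_cball.
Qed.

Lemma unit_diskE p : unit_disk p <-> sqdist p < 1.
Proof. exact: disk_sqr. Qed.

Lemma ge0_integral_unit_disk (f : P -> \bar R) : measurable_fun unit_disk f ->
  (forall p, unit_disk p -> (0 <= f p)%E) ->
  (\int[@area R]_(p in cball (@exhaust R k)) f p)%E @[k --> \oo] -->
  (\int[@area R]_(p in unit_disk) f p)%E.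
Proof.
move=> mf f0; have sub k : cball (@exhaust R k) `<=` unit_disk.
  by rewrite /unit_disk cball_exhaust_bigcup => p pk; exists k.
rewrite /unit_disk cball_exhaust_bigcup.
apply: ge0_nondecreasing_set_cvg_integral.
- exact: cball_exhaust_nd.
- by move=> k; exact: measurable_cball.
- by move=> k; exact: measurable_funS measurable_unit_disk (sub k) mf.
- by move=> k p /sub; exact: f0.
Qed.

Variable alpha : R.
Hypothesis alpha1 : -1 < alpha.
Local Notation W := (radial_weight alpha).

Definition moment n : R :=
  \int[@area R]_(p in unit_disk) (sqdist p ^+ n * W (sqdist p)).

Lemma moment_upto_le rho n : 0 <= rho < 1 ->
  moment_upto alpha rho n <= moment_upto alpha rho 0.
Proof.
move=> /andP[r0 r1]; apply: le_Rintegral.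
- exact: measurable_cball.
- exact: integrable_moment_upto.
- exact: integrable_moment_upto.
- move=> p pr; rewrite ler_wpM2r ?radial_weight_ge0// expr0 exprn_ile1 ?sqdist_ge0//.
  exact: le_trans pr (ltW r1).
Qed.

Let moment_cvgE n :
  (moment_upto alpha (exhaust R k) n)%:E @[k --> \oo] -->
  (\int[@area R]_(p in unit_disk) (sqdist p ^+ n * W (sqdist p))%:E)%E.
Proof.
have mf : measurable_fun unit_disk (fun p : P => (sqdist p ^+ n * W (sqdist p))%:E).
  apply/measurable_EFinP; exact: measurable_funS (measurable_moment alpha n).
have f0 p : unit_disk p -> (0 <= (sqdist p ^+ n * W (sqdist p))%:E)%E.
  by move=> _; rewrite lee_fin mulr_ge0 ?exprn_ge0 ?sqdist_ge0 ?radial_weight_ge0.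
have := ge0_integral_unit_disk mf f0; apply: cvg_trans; apply: near_eq_cvg.
apply: nearW => k /=; rewrite /moment_upto fineK//.
have /andP[_ r1] := exhaust01 R k.
apply: integrable_fin_num; first exact: measurable_cball.
exact: (integrable_moment_upto alpha1 n r1).
Qed.

Lemma integrable_moment n : (@area R).-integrable unit_disk
  (fun p => (sqdist p ^+ n * W (sqdist p))%:E).
Proof.
apply/integrableP; split.
  apply/measurable_EFinP; exact: measurable_funS (measurable_moment alpha n).
under eq_integral => p _.
  rewrite gee0_abs; last first.
    by rewrite lee_fin mulr_ge0 ?exprn_ge0 ?sqdist_ge0 ?radial_weight_ge0.
  over.
pose B := 4 * (pi^-1 * (alpha + 1)) * (alpha + 2) / (alpha + 1).
apply: (@le_lt_trans _ _ B%:E); last exact: ltry.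
have h := @moment_cvgE n.
rewrite -(cvg_lim _ h)//; apply: lime_le; first by apply/cvg_ex; eexists; exact: h.
apply: nearW => k; rewrite lee_fin.
have r01 := exhaust01 R k.
exact: le_trans (moment_upto_le n r01) (moment_upto_bounded alpha1 r01).
Qed.

Lemma moment_cvg n : moment_upto alpha (exhaust R k) n @[k --> \oo] --> moment n.
Proof.
apply: (@fine_cvg _ _ _ _ (fun k => (moment_upto alpha (exhaust R k) n)%:E)).
rewrite fineK; first exact: moment_cvgE.
apply: integrable_fin_num; first exact: measurable_unit_disk.
exact: integrable_moment.
Qed.

(** The flux term of [moment_upto_step] is O((1 - rho)^(alpha + 1)) and
disappears in the limit rho -> 1. *)
Lemma moment_step n : n.+1%:R * moment n = (alpha + 2 + n%:R) * moment n.+1.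
Proof.
apply/eqP; rewrite -subr_eq0; apply/eqP.
pose K := pi^-1 * (alpha + 1).
pose mk k j := moment_upto alpha (exhaust R k) j.
have h1 : (fun k => n.+1%:R * mk k n - (n%:R + alpha + 2) * mk k n.+1) @ \oo -->
   n.+1%:R * moment n - (n%:R + alpha + 2) * moment n.+1.
  by apply: cvgB; apply: cvgM;
    [exact: cvg_cst|exact: moment_cvg|exact: cvg_cst|exact: moment_cvg].
have h2 : (fun k => 4 * K * (1 - exhaust R k) `^ (alpha + 1)) @ \oo --> (0 : R).
  rewrite -(mulr0 (4 * K)); apply: cvgM; first exact: cvg_cst.
  have a1 : 0 < alpha + 1 by rewrite -ltrBlDr sub0r.
  have /cvg_at_rightP := powR_cvg0 a1; apply; split.
    by move=> k; have /andP[_] := exhaust01 R k; rewrite subr_gt0.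
  rewrite (_ : (fun k => _) = @harmonic R); first exact: cvg_harmonic.
  by apply/funext => k; rewrite /exhaust subKr.
have h3 : (fun k => n.+1%:R * mk k n - (n%:R + alpha + 2) * mk k n.+1) @ \oo --> (0 : R).
  apply: (squeeze_cvgr _ (cvg_cst (0 : R)) h2).
  apply: nearW => k; exact: moment_upto_step (exhaust01 R k).
rewrite (_ : alpha + 2 + n%:R = n%:R + alpha + 2); last by ring.
exact: cvg_unique h1 h3.
Qed.

(** The weight is bounded below on a square inside the disk. *)
Lemma moment0_gt0 : 0 < moment 0.
Proof.
pose J : set mR := `[0, 2^-1]%classic; pose S : set P := J `*` J.
have mJ : measurable J by exact: measurable_itv.
have mS : measurable S by exact: measurableX.
have areaS : @area R S = (4^-1)%:E.
  rewrite [LHS]product_measure1E//= /J !lebesgue_measure_itv/= lte_fin.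
  rewrite ifT ?invr_gt0// -EFinB -EFinM; congr EFin; lra.
have qS p : S p -> sqdist p <= 2^-1.
  by rewrite /S/J/sqdist/= !in_itv/= => -[/andP[? ?] /andP[? ?]]; nra.
have SD : S `<=` unit_disk by move=> p /qS ?; apply/unit_diskE; lra.
have a1 : 0 < alpha + 1 by rewrite -ltrBlDr sub0r.
pose c := pi^-1 * (alpha + 1) * 2^-1 `^ (alpha + 1).
have c0 : 0 < c by rewrite !mulr_gt0 ?invr_gt0 ?pi_gt0 ?powR_gt0.
have cW p : S p -> c <= W (sqdist p).
  move=> /qS q2; have q0 := sqdist_ge0 p.
  rewrite /c /radial_weight ler_wpM2l ?mulr_ge0 ?invr_ge0 ?pi_ge0 ?(ltW a1)//.
  apply: (@le_trans _ _ ((1 - sqdist p) `^ (alpha + 1))).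
    by apply: ge0_ler_powR; rewrite ?nnegrE ?(ltW a1)//; lra.
  rewrite powR_succ//; last lra.
  by rewrite ler_piMr ?powR_ge0//; lra.
have mW := measurable_moment alpha 0.
have W0 p : (0 <= (sqdist p ^+ 0 * W (sqdist p))%:E)%E.
  by rewrite lee_fin mulr_ge0 ?exprn_ge0 ?sqdist_ge0 ?radial_weight_ge0.
rewrite /moment -lte_fin fineK; last first.
  apply: integrable_fin_num; first exact: measurable_unit_disk.
  exact: integrable_moment.
apply: (@lt_le_trans _ _ (\int[@area R]_(p in S) c%:E)%E).
  by rewrite integral_cst//= areaS -EFinM lte_fin mulr_gt0// invr_gt0.
apply: (@le_trans _ _ (\int[@area R]_(p in S) (sqdist p ^+ 0 * W (sqdist p))%:E)%E).
  apply: ge0_le_integral => //.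
  - by move=> p _; rewrite lee_fin ltW.
  - apply/measurable_EFinP; exact: measurable_funS mW.
  - by move=> p pS; rewrite lee_fin expr0 mul1r cW.
apply: ge0_subset_integral => //.
- exact: measurable_unit_disk.
- apply/measurable_EFinP; exact: measurable_funS mW.
Qed.

Lemma moment_gt0 n : 0 < moment n.
Proof.
elim: n => [|n ih]; first exact: moment0_gt0.
have s0 : 0 < alpha + 2 + n%:R by have a1 := alpha1; have := ler0n R n; lra.
by rewrite -(pmulr_rgt0 _ s0) -moment_step mulr_gt0.
Qed.

End DiskMoments.

(** The two recurrences have reciprocal ratios. *)
Lemma moment_binomial_coef (R : realType) (s : R) (m : nat -> R) :
  (forall n, n.+1%:R * m n = (s + n%:R) * m n.+1) ->
  forall n, m n * binomial_coef s n = m 0.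
Proof.
move=> hm; elim => [|n ih]; first by rewrite /binomial_coef big_ord0 mulr1.
have n0 : n.+1%:R != 0 :> R by rewrite pnatr_eq0.
apply: (mulfI n0); rewrite mulrCA binomial_coefS mulrA [m _ * _]mulrC -hm -ih.
by rewrite mulrA.
Qed.

(** * Orthogonality of the monomials *)

Section Orthogonality.
Variable R : realType.
Local Notation mR := (measurableTypeR R).
Local Notation P := (mR * mR)%type.

Definition cmeasurable (F : P -> R[i]) :=
  measurable_fun setT (fun p => Re (F p)) /\ measurable_fun setT (fun p => Im (F p)).

Lemma cmeasurable_pt : cmeasurable (@pt R).
Proof. by split; [exact: measurable_fst|exact: measurable_snd]. Qed.

Lemma cmeasurable_cst c : cmeasurable (fun=> c).
Proof. by split; exact: measurable_cst. Qed.

Lemma cmeasurableD F G : cmeasurable F -> cmeasurable G -> cmeasurable (fun p => F p + G p).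
Proof.
move=> [F1 F2] [G1 G2]; split.
  by under eq_fun do rewrite cReD; exact: measurable_funD.
by under eq_fun do rewrite cImD; exact: measurable_funD.
Qed.

Lemma cmeasurableM F G : cmeasurable F -> cmeasurable G -> cmeasurable (fun p => F p * G p).
Proof.
move=> [F1 F2] [G1 G2]; split.
  by under eq_fun do rewrite cReM; apply: measurable_funB; exact: measurable_funM.
by under eq_fun do rewrite cImM; apply: measurable_funD; exact: measurable_funM.
Qed.

Lemma cmeasurableX F n : cmeasurable F -> cmeasurable (fun p => F p ^+ n).
Proof.
move=> mF; elim: n => [|n ih]; first exact: cmeasurable_cst.
by under eq_fun do rewrite exprS; exact: cmeasurableM.
Qed.

Lemma cmeasurableJ F : cmeasurable F -> cmeasurable (fun p => (F p)^*).
Proof.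
move=> [F1 F2]; split; first by under eq_fun do rewrite cReJ.
by under eq_fun do rewrite cImJ; exact: measurable_funN.
Qed.

Lemma cmeasurable_sum (F : nat -> P -> R[i]) N : (forall n, cmeasurable (F n)) ->
  cmeasurable (fun p => \sum_(i < N) F i p).
Proof.
move=> mF; elim: N => [|N ih].
  by under eq_fun do rewrite big_ord0; exact: cmeasurable_cst.
by under eq_fun do rewrite big_ord_recr/=; exact: cmeasurableD.
Qed.

Definition cis (t : R) : R[i] := cos t +i* sin t.

Lemma cisD s t : cis (s + t) = cis s * cis t.
Proof. by apply: complex_eqP; rewrite ?cReM ?cImM/= ?cosD ?sinD; ring. Qed.

Lemma cis0 : cis 0 = 1. Proof. by rewrite /cis cos0 sin0. Qed.

Lemma cisX t n : cis t ^+ n = cis (n%:R * t).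
Proof.
elim: n => [|n ih]; first by rewrite mul0r cis0.
by rewrite exprS ih -cisD -nat1r mulrDl mul1r.
Qed.

Lemma cisJ t : (cis t)^* = cis (- t).
Proof. by rewrite /cis cosN sinN. Qed.

Lemma pt_rotation t (p : P) : pt (rotation (cos t) (sin t) p) = cis t * pt p.
Proof. by apply: complex_eqP; rewrite ?cReM ?cImM/= /rotation/=; ring. Qed.

Lemma sqdist_rotation t (p : P) : sqdist (rotation (cos t) (sin t) p) = sqdist p.
Proof.
have := cos2Dsin2 t; rewrite /sqdist /rotation/= => cs.
rewrite -[RHS]mul1r -cs; ring.
Qed.

Lemma sqdist_normc (p : P) : sqdist p = normc (pt p) ^+ 2.
Proof. by rewrite normc_sqr. Qed.

Section Monomials.
Variables (alpha rho : R).
Hypothesis alpha1 : -1 < alpha.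
Hypothesis rho01 : 0 <= rho < 1.
Local Notation W := (radial_weight alpha).

(** The coefficient C is kept inside the real part: as C varies, these real
functions carry all the information of the complex integrand. *)
Definition monomial (C : R[i]) i j (p : P) : R :=
  Re (C * pt p ^+ i * (pt p)^* ^+ j) * W (sqdist p).

Lemma measurable_monomial C i j : measurable_fun setT (monomial C i j).
Proof.
apply: measurable_funM.
  have : cmeasurable (fun p => C * pt p ^+ i * (pt p)^* ^+ j).
    apply: cmeasurableM; last first.
      by apply: cmeasurableX; apply: cmeasurableJ; exact: cmeasurable_pt.
    apply: cmeasurableM; first exact: cmeasurable_cst.
    by apply: cmeasurableX; exact: cmeasurable_pt.
  by case.
exact: measurableT_comp (measurable_radial_weight alpha) (@measurable_sqdist R).
Qed.

Lemma integrable_monomial C i j :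
  (@area R).-integrable (cball rho) (EFin \o monomial C i j).
Proof.
have [r0 r1] := andP rho01.
have /(integrableZl (@measurable_cball R rho) (normc C)) IW :=
  integrable_moment_upto alpha1 0 r1.
apply: le_integrable IW.
- exact: measurable_cball.
- apply/measurable_EFinP; exact: measurable_funS (measurable_monomial C i j).
- move=> p pr /=; rewrite lee_fin expr0 mul1r !normrM !(ger0_norm (normc_ge0 _)).
  rewrite ler_wpM2r// (le_trans (Re_le_normc _))//.
  rewrite !Normc.normcM !normcX normcJ -mulrA ler_piMr ?normc_ge0//.
  have z1 : normc (pt p) <= 1.
    rewrite -(@expr_le1 _ 2)// ?normc_ge0// -sqdist_normc.
    by rewrite (le_trans pr)// ltW.
  by rewrite mulr_ile1 ?exprn_ge0 ?exprn_ile1 ?normc_ge0.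
Qed.

Lemma integral_monomial_rotation C i j t : sin t != 0 ->
  \int[@area R]_(p in cball rho) monomial C i j p =
  \int[@area R]_(p in cball rho) monomial (C * cis ((i%:R - j%:R) * t)) i j p.
Proof.
move=> st; have mb := @measurable_cball R rho.
have rot : area_preserving (rotation (cos t) (sin t)).
  by apply: area_preserving_rotation => //; exact: cos2Dsin2.
have rotball : rotation (cos t) (sin t) @^-1` cball rho = cball rho.
  by apply/seteqP; split => p; rewrite /cball/= sqdist_rotation.
have mono p : monomial C i j (rotation (cos t) (sin t) p) =
    monomial (C * cis ((i%:R - j%:R) * t)) i j p.
  rewrite /monomial pt_rotation sqdist_rotation.
  have -> : C * (cis t * pt p) ^+ i * (cis t * pt p)^* ^+ j =
      C * cis ((i%:R - j%:R) * t) * pt p ^+ i * (pt p)^* ^+ j.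
    have cJ : (cis t * pt p)^* = cis (- t) * (pt p)^* by rewrite -cisJ -rmorphM.
    rewrite cJ !exprMn !cisX mulrBl cisD mulrN; ring.
  by [].
congr fine; rewrite -(integral_area_preserving rot mb (f := EFin \o monomial C i j)).
- by rewrite rotball; apply: eq_integral => p _ /=; rewrite mono.
- by apply/measurable_EFinP; exact: measurable_monomial.
- rewrite rotball; have := integrable_monomial (C * cis ((i%:R - j%:R) * t)) i j.
  by apply: eq_integrable => // p _ /=; rewrite mono.
Qed.

(** Rotating by t multiplies C by cis ((i - j) t).  For t = pi / (2 (i - j)) this
factor is the imaginary unit, so two rotations turn the integral into its
opposite.  One rotation by 2 t would not do for |i - j| = 1, when it is a half
turn and hence not a product of three shears. *)
Lemma integral_monomial_orthogonal C i j : i != j ->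
  \int[@area R]_(p in cball rho) monomial C i j p = 0.
Proof.
move=> ij; pose t : R := (i%:R - j%:R)^-1 * (pi / 2).
have d0 : i%:R - j%:R != 0 :> R by rewrite subr_eq0 eqr_nat.
have st : sin t != 0.
  have key k : (0 < k)%N -> 0 < sin (k%:R^-1 * (pi / 2) : R).
    move=> k0; apply: sin_gt0_pi; have p0 := pi_gt0 R.
    have k1 : k%:R^-1 <= 1 :> R by rewrite invf_le1 ?ltr0n// ler1n.
    have k2 : 0 < k%:R^-1 :> R by rewrite invr_gt0 ltr0n.
    by apply/andP; split; nra.
  rewrite /t; case: (ltngtP i j) ij => // h _.
    rewrite -opprB invrN mulNr sinN oppr_eq0 -natrB 1?ltnW//.
    by rewrite gt_eqF// key// subn_gt0.
  by rewrite -natrB 1?ltnW// gt_eqF// key// subn_gt0.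
have two := integral_monomial_rotation (C * cis ((i%:R - j%:R) * t)) i j st.
rewrite -(integral_monomial_rotation _ _ _ st) in two.
have ci : cis ((i%:R - j%:R) * t) * cis ((i%:R - j%:R) * t) = -1.
  rewrite /t mulrA divff// mul1r -cisD -splitr /cis cospi sinpi.
  by apply: complex_eqP; rewrite ?cReN ?cImN/= ?oppr0.
rewrite -mulrA ci mulrN1 in two.
suff : \int[@area R]_(p in cball rho) monomial (- C) i j p =
  - \int[@area R]_(p in cball rho) monomial C i j p.
  by move=> h; move: two; rewrite h; lra.
rewrite -[RHS]mulN1r -RintegralZl//.
- by apply: eq_Rintegral => p _; rewrite /monomial !mulNr cReN; ring.
- exact: measurable_cball.
- exact: integrable_monomial.
Qed.

End Monomials.

Lemma Rintegral_sum d (T : measurableType d) (m : {measure set T -> \bar R})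
    (D : set T) (f : nat -> T -> R) N : measurable D ->
  (forall n, m.-integrable D (EFin \o f n)) ->
  m.-integrable D (EFin \o (fun x => \sum_(n < N) f n x)) /\
  \int[m]_(x in D) (\sum_(n < N) f n x) = \sum_(n < N) \int[m]_(x in D) f n x.
Proof.
move=> mD If; elim: N => [|N [ih1 ih2]].
  under eq_fun do rewrite big_ord0; split.
    by apply: eq_integrable (integrable0 _ _) => // x _ /=; rewrite big_ord0.
  by rewrite big_ord0 Rintegral_cst// mul0r.
have E : (fun x => \sum_(n < N.+1) f n x) = (fun x => \sum_(n < N) f n x + f N x).
  by apply/funext => x; rewrite big_ord_recr.
split; first by rewrite E; exact: (integrableD mD ih1 (If N)).
by rewrite E RintegralD// ih2 big_ord_recr.
Qed.

Section FiniteParseval.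
Variables (alpha rho : R).
Hypothesis alpha1 : -1 < alpha.
Hypothesis rho01 : 0 <= rho < 1.
Local Notation W := (radial_weight alpha).

Definition partial_sum (c : nat -> R[i]) N (z : R[i]) : R[i] := \sum_(n < N) c n * z ^+ n.

(** Expanding the square into monomials leaves the diagonal terms only. *)
Lemma parseval_partial_sum c N :
  \int[@area R]_(p in cball rho) (normc (partial_sum c N (pt p)) ^+ 2 * W (sqdist p)) =
  \sum_(n < N) normc (c n) ^+ 2 * moment_upto alpha rho n.
Proof.
have mb := @measurable_cball R rho.
have normE p : normc (partial_sum c N (pt p)) ^+ 2 * W (sqdist p) =
    \sum_(i < N) \sum_(j < N) monomial alpha (c i * (c j)^*) i j p.
  have -> : normc (partial_sum c N (pt p)) ^+ 2 =
      Re (partial_sum c N (pt p) * (partial_sum c N (pt p))^*).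
    by rewrite normc_sqr cReM cReJ cImJ; ring.
  rewrite {2}/partial_sum rmorph_sum /partial_sum.
  rewrite big_distrlr/= Re_sum mulr_suml.
  apply: eq_bigr => i _; rewrite Re_sum mulr_suml; apply: eq_bigr => j _.
  rewrite /monomial rmorphM rmorphXn.
  have -> : c i * pt p ^+ i * ((c j)^* * (pt p)^* ^+ j) =
    c i * (c j)^* * pt p ^+ i * (pt p)^* ^+ j by ring.
  by [].
under eq_Rintegral do rewrite normE.
have Ij i := Rintegral_sum N mb
  (fun j => integrable_monomial alpha1 rho01 (c i * (c j)^*) i j).
rewrite (Rintegral_sum N mb (fun i => (Ij i).1)).2; apply: eq_bigr => i _.
rewrite (Ij i).2 (bigD1 i)//= big1 ?addr0; last first.
  by move=> j ji; apply: integral_monomial_orthogonal => //; rewrite eq_sym.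
rewrite /moment_upto -RintegralZl//; last first.
  by have [r0 r1] := andP rho01; exact: integrable_moment_upto.
apply: eq_Rintegral => p _; rewrite /monomial mulrA.
have -> : Re (c i * (c i)^* * pt p ^+ i * (pt p)^* ^+ i) =
    normc (c i) ^+ 2 * sqdist p ^+ i.
  rewrite sqdist_normc -exprM mulnC exprM -(normcX (pt p)) !normc_sqr -rmorphXn.
  move: (pt p ^+ i) (c i) => z w.
  rewrite !cReImE; ring.
by [].
Qed.

End FiniteParseval.
End Orthogonality.

(** * Parseval's identity *)

Section Parseval.
Variable R : realType.
Local Notation mR := (measurableTypeR R).
Local Notation P := (mR * mR)%type.
Local Notation D := (@unit_disk R).
Implicit Types (f : R[i] -> R[i]) (c : nat -> R[i]^o).

Lemma expandsP f c : expands f c <-> forall z, disk z ->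
  (fun N => partial_sum c N z : R[i]^o) @ \oo --> (f z : R[i]^o).
Proof.
have E z : series (fun n => c n * z ^+ n) = (fun N => partial_sum c N z).
  by apply/funext => N; rewrite /series/= big_mkord.
by split => h z /h; rewrite E.
Qed.

(** Convergence at a real point s between r and 1 gives absolute convergence of
both coordinate series at r. *)
Lemma partial_sum_bounded f c (r : R) : expands f c -> 0 <= r < 1 ->
  exists M : R, forall N z, normc z <= r -> normc (partial_sum c N z) <= M.
Proof.
move=> /expandsP fc /andP[r0 r1]; pose s := (1 + r) / 2.
have [rs s1] : r < s /\ s < 1 by rewrite /s; split; lra.
have s0 : 0 <= s by lra.
have ds : disk s%:C by apply/disk_normc; rewrite normc_real ger0_norm.
have [cRe cIm] := (cvg_complexP _ _).1 (fc _ ds).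
have cvgs (p : R[i] -> R) : (p = @complex.Re R \/ p = @complex.Im R) ->
    cvgn (pseries (fun n => `|p (c n)|) r).
  move=> hp; apply: (@is_cvg_pseries_inside_norm _ (fun n => p (c n)) s); last first.
    by rewrite !ger0_norm.
  have -> : pseries (fun n => p (c n)) s = fun N => p (partial_sum c N s%:C).
    apply/funext => N; rewrite /pseries /series/= big_mkord /partial_sum.
    by case: hp => ->; rewrite ?Re_sum ?Im_sum; apply: eq_bigr => i _;
      rewrite -rmorphXn/= mulrC ?cReM ?cImM/= ?mulr0 ?mul0r ?subr0 ?addr0 mulrC ?add0r.
  by case: hp => ->; apply/cvg_ex; eexists; [exact: cRe|exact: cIm].
have nd (p : R[i] -> R) : nondecreasing_seq (pseries (fun n => `|p (c n)|) r).
  apply/nondecreasing_seqP => n; rewrite /pseries /series/= big_nat_recr//= lerDl.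
  by rewrite mulr_ge0// exprn_ge0.
exists (limn (pseries (fun n => `|Re (c n)|) r) + limn (pseries (fun n => `|Im (c n)|) r)).
move=> N z zr.
have h1 := nondecreasing_cvgn_le (nd _) (cvgs _ (or_introl erefl)) N.
have h2 := nondecreasing_cvgn_le (nd _) (cvgs _ (or_intror erefl)) N.
apply: le_trans (lerD h1 h2).
rewrite /pseries /series/= !big_mkord -big_split/= /partial_sum.
elim/big_rec2 : _ => [|i y1 y2 _ ih]; first by rewrite Normc.normc0.
rewrite (le_trans (normc_triangle _ _))// lerD// Normc.normcM normcX -mulrDl.
by rewrite ler_pM ?exprn_ge0 ?normc_ge0 ?normc_le// lerXn2r ?nnegrE ?normc_ge0.
Qed.

(** An analytic function is on the disk a pointwise limit of polynomials. *)
Lemma measurable_analytic f c : expands f c ->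
  measurable_fun D (fun p => Re (f (pt p))) /\ measurable_fun D (fun p => Im (f (pt p))).
Proof.
move=> /expandsP fc.
have ms N : cmeasurable (fun p : P => partial_sum c N (pt p)).
  apply: (@cmeasurable_sum _ (fun n p => c n * pt p ^+ n)) => n.
  apply: cmeasurableM; first exact: cmeasurable_cst.
  by apply: cmeasurableX; exact: cmeasurable_pt.
have mD := @measurable_unit_disk R.
split.
- apply: (@measurable_fun_cvg _ _ _ _ (fun N p => Re (partial_sum c N (pt p)))).
    by move=> N; apply: measurable_funS (ms N).1.
  by move=> p Dp; have [] := (cvg_complexP _ _).1 (fc _ Dp).
- apply: (@measurable_fun_cvg _ _ _ _ (fun N p => Im (partial_sum c N (pt p)))).
    by move=> N; apply: measurable_funS (ms N).2.
  by move=> p Dp; have [] := (cvg_complexP _ _).1 (fc _ Dp).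
Qed.

Variable alpha : R.
Hypothesis alpha1 : -1 < alpha.
Local Notation W := (radial_weight alpha).

Lemma measurable_sqnorm f c : expands f c ->
  measurable_fun D (fun p => normc (f (pt p)) ^+ 2 * W (sqdist p)).
Proof.
move=> /measurable_analytic [mRe mIm].
under eq_fun do rewrite normc_sqr.
apply: measurable_funM.
  by apply: measurable_funD; exact: measurable_funX.
have mD := @measurable_unit_disk R.
apply: (@measurable_funS _ _ _ _ setT) => //.
exact: measurableT_comp (measurable_radial_weight alpha) (@measurable_sqdist R).
Qed.

Lemma cball_sub_disk rho : rho < 1 -> cball rho `<=` D.
Proof. by move=> r1 p pr; apply/unit_diskE; exact: le_lt_trans r1. Qed.

(** On a smaller disc the partial sums are uniformly bounded, which allows
dominated convergence. *)
Lemma parseval_cball f c rho : expands f c -> 0 <= rho < 1 ->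
  (fun N => (\sum_(n < N) normc (c n) ^+ 2 * moment_upto alpha rho n)%:E) @ \oo -->
  (\int[@area R]_(p in cball rho) (normc (f (pt p)) ^+ 2 * W (sqdist p))%:E)%E.
Proof.
move=> fc rho01; have [r0 r1] := andP rho01.
have mb := @measurable_cball R rho.
have [M hM] : exists M : R, forall N z,
    normc z <= Num.sqrt rho -> normc (partial_sum c N z) <= M.
  apply: (partial_sum_bounded fc); rewrite sqrtr_ge0/=.
  by rewrite -sqrtr1 ltr_sqrt.
pose F N (p : P) := (normc (partial_sum c N (pt p)) ^+ 2 * W (sqdist p))%:E.
have zr (p : P) : cball rho p -> normc (pt p) <= Num.sqrt rho.
  move=> pr; rewrite -[leLHS]ger0_norm ?normc_ge0// -sqrtr_sqr ler_wsqrtr//.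
  by rewrite -sqdist_normc.
have mF N : measurable_fun (cball rho) (F N).
  apply/measurable_EFinP; apply: measurable_funM.
    under eq_fun do rewrite normc_sqr.
    have [mRe mIm] : cmeasurable (fun p : P => partial_sum c N (pt p)).
      apply: (@cmeasurable_sum _ (fun n p => c n * pt p ^+ n)) => n.
      apply: cmeasurableM; first exact: cmeasurable_cst.
      by apply: cmeasurableX; exact: cmeasurable_pt.
    by apply: measurable_funD; apply: measurable_funX; apply: measurable_funTS.
  apply: measurable_funTS.
  exact: measurableT_comp (measurable_radial_weight alpha) (@measurable_sqdist R).
have FM N p : cball rho p ->
    (`|F N p| <= (M ^+ 2)%:E * (sqdist p ^+ 0 * W (sqdist p))%:E)%E.
  move=> /zr pr; have F0 : (0 <= F N p)%E.
    by rewrite lee_fin mulr_ge0 ?sqr_ge0 ?radial_weight_ge0.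
  rewrite gee0_abs// /F -EFinM lee_fin expr0 mul1r ler_wpM2r ?radial_weight_ge0//.
  have n0 := normc_ge0 (partial_sum c N (pt p)).
  by rewrite lerXn2r ?nnegrE ?(le_trans n0) ?normc_ge0 ?hM.
have IW := integrableZl mb (M ^+ 2) (integrable_moment_upto alpha1 0 r1).
have IF N : (@area R).-integrable (cball rho) (F N).
  by apply: le_integrable IW => // p pr; rewrite (le_trans (FM N p pr))// lee_abs.
have Fpar : (fun N => (\sum_(n < N) normc (c n) ^+ 2 * moment_upto alpha rho n)%:E) =
    (fun N => \int[@area R]_(p in cball rho) F N p)%E.
  apply/funext => N; rewrite -parseval_partial_sum// /Rintegral fineK//.
  apply: (@integrable_fin_num _ _ _ (@area R) _ mb (F N)); exact: IF.
rewrite Fpar.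
pose G (p : P) := (normc (f (pt p)) ^+ 2 * W (sqdist p))%:E.
have mG : measurable_fun (cball rho) G.
  apply/measurable_EFinP; apply: measurable_funS (measurable_sqnorm fc).
    exact: measurable_unit_disk.
  exact: cball_sub_disk.
have FG p : cball rho p -> F ^~ p @ \oo --> G p.
  move=> pr; apply: cvg_EFin; first exact: nearW.
  have [hRe hIm] :=
    (cvg_complexP _ _).1 ((expandsP f c).1 fc _ (cball_sub_disk r1 pr)).
  apply: cvgM; last exact: cvg_cst.
  rewrite normc_sqr; under eq_fun do rewrite normc_sqr.
  by apply: cvgD; rewrite expr2; under eq_fun do rewrite expr2; apply: cvgM.
have [_ _] := dominated_convergence mb mF mG (aeW (@area R) FG) IW
  (aeW (@area R) (fun p N => FM N p)).
exact.
Qed.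

Lemma moment_upto_le_moment rho n : rho < 1 -> moment_upto alpha rho n <= moment alpha n.
Proof.
move=> r1; have mb := @measurable_cball R rho.
have mD := @measurable_unit_disk R.
rewrite -lee_fin !fineK.
- apply: ge0_subset_integral => //.
  + apply/measurable_EFinP; apply: measurable_funTS; exact: measurable_moment.
  + by move=> p _; rewrite lee_fin mulr_ge0 ?exprn_ge0 ?sqdist_ge0 ?radial_weight_ge0.
  + exact: cball_sub_disk.
- by apply: integrable_fin_num => //; exact: integrable_moment.
- by apply: integrable_fin_num => //; exact: integrable_moment_upto.
Qed.

(** Both sides are increasing limits in the radius and in the number of terms, so
the two limits can be exchanged; each inequality takes one of them first. *)
Lemma parseval f c : expands f c ->
  (\int[@area R]_(p in D) (normc (f (pt p)) ^+ 2 * W (sqdist p))%:E)%E =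
  (\sum_(n <oo) (moment alpha n * normc (c n) ^+ 2)%:E)%E.
Proof.
move=> fc.
have t0 n : (0 <= (moment alpha n * normc (c n) ^+ 2)%:E)%E.
  by rewrite lee_fin mulr_ge0 ?sqr_ge0// ltW// moment_gt0.
pose F (p : P) := (normc (f (pt p)) ^+ 2 * W (sqdist p))%:E.
have lim1 : (\int[@area R]_(p in cball (exhaust R k)) F p)%E @[k --> \oo] -->
  (\int[@area R]_(p in D) F p)%E.
  apply: ge0_integral_unit_disk.
    by apply/measurable_EFinP; exact: measurable_sqnorm fc.
  by move=> p _; rewrite lee_fin mulr_ge0 ?sqr_ge0 ?radial_weight_ge0.
apply/eqP; rewrite eq_le; apply/andP; split.
  rewrite -(cvg_lim _ lim1)//; apply: lime_le; first by apply/cvg_ex; eexists; exact: lim1.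
  apply: nearW => k; have h := parseval_cball fc (exhaust01 R k).
  rewrite -(cvg_lim _ h)//; apply: lime_le; first by apply/cvg_ex; eexists; exact: h.
  apply: nearW => N; apply: le_trans (nneseries_lim_ge N (fun n _ _ => t0 n)).
  rewrite big_mkord sumEFin lee_fin; apply: ler_sum => n _.
  rewrite mulrC ler_wpM2r ?sqr_ge0// moment_upto_le_moment//.
  by have /andP[] := exhaust01 R k.
apply: lime_le; first exact: is_cvg_nneseries.
apply: nearW => N; rewrite big_mkord sumEFin.
have lim2 : (\sum_(n < N) normc (c n) ^+ 2 * moment_upto alpha (exhaust R k) n)%:E
      @[k --> \oo] -->
    (\sum_(n < N) moment alpha n * normc (c n) ^+ 2)%:E.
  apply: cvg_EFin; first exact: nearW.
  rewrite /comp/=; elim: N => [|N ih].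
    by rewrite big_ord0; under eq_fun do rewrite big_ord0; exact: cvg_cst.
  rewrite big_ord_recr/=; under eq_fun do rewrite big_ord_recr/=.
  by apply: cvgD ih _; rewrite mulrC; apply: cvgM; [exact: cvg_cst|exact: moment_cvg].
rewrite -(cvg_lim _ lim2)// -(cvg_lim _ lim1)//; apply: lee_lim.
- by apply/cvg_ex; eexists; exact: lim2.
- by apply/cvg_ex; eexists; exact: lim1.
apply: nearW => k; have h := parseval_cball fc (exhaust01 R k).
rewrite -(cvg_lim _ h)//; apply: lime_ge; first by apply/cvg_ex; eexists; exact: h.
exists N => // m /= Nm; rewrite lee_fin -(subnKC Nm) big_split_ord/= lerDl.
by apply: sumr_ge0 => i _; rewrite mulr_ge0 ?sqr_ge0 ?moment_upto_ge0.
Qed.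
End Parseval.

(** * The two spaces as weighted l^2 spaces *)

Section Spaces.
Variable R : realType.
Local Notation mR := (measurableTypeR R).
Local Notation P := (mR * mR)%type.
Local Notation D := (@unit_disk R).
Implicit Types (f g : R[i] -> R[i]) (c d : nat -> R[i]^o) (H : function_space R).

Lemma nneseries_fine_cvg (u : nat -> R) : (forall n, 0 <= u n) ->
  (\sum_(n <oo) (u n)%:E < +oo)%E ->
  (fun N => \sum_(n < N) u n) @ \oo --> fine (\sum_(n <oo) (u n)%:E)%E.
Proof.
move=> u0 uoo; have u0' n : xpredT n -> (0 <= (u n)%:E)%E by rewrite lee_fin.
have ufin : (\sum_(n <oo) (u n)%:E)%E \is a fin_num.
  by rewrite ge0_fin_numE// nneseries_ge0// => n _; rewrite lee_fin.
have h : (fun N => \sum_(0 <= n < N) (u n)%:E)%E @ \oo --> (\sum_(n <oo) (u n)%:E)%E.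
  by apply: is_cvg_nneseries => n _; exact: u0'.
move: h; rewrite -[X in _ --> X -> _](fineK ufin) => /fine_cvg.
rewrite (_ : fine \o _ = fun N => \sum_(n < N) u n)//.
by apply/funext => N /=; rewrite big_mkord sumEFin.
Qed.

Lemma nneseries_cvg_lty (u : nat -> R) (l : R) : (forall n, 0 <= u n) ->
  (fun N => \sum_(n < N) u n) @ \oo --> l -> (\sum_(n <oo) (u n)%:E < +oo)%E.
Proof.
move=> u0 ul; have -> : (\sum_(n <oo) (u n)%:E)%E = l%:E; last exact: ltry.
apply/cvg_lim => //; under eq_fun do rewrite /= big_mkord sumEFin/=.
by apply: cvg_EFin => //; exact: nearW.
Qed.

Lemma expands_lin f g c d (k : R[i]) : expands f c -> expands g d ->
  expands (fun z => f z + k * g z) (fun n => c n + k * d n : R[i]^o).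
Proof.
move=> /expandsP fc /expandsP gd; apply/expandsP => z Dz.
have E : partial_sum (fun n => c n + k * d n) ^~ z =
    (fun N => partial_sum c N z + k * partial_sum d N z).
  apply/funext => N; rewrite /partial_sum mulr_sumr -big_split/=.
  by apply: eq_bigr => n _; rewrite mulrDl mulrA.
rewrite E; apply: cvgD; first exact: fc.
exact: (cvgZl_tmp (k := k) (gd z Dz)).
Qed.

(** Parseval's identity for the difference of two expansions of f, with the
unweighted area alpha = 0: every term of a vanishing sum of nonnegative terms
vanishes. *)
Lemma expands_inj f c d : expands f c -> expands f d -> c = d.
Proof.
move=> fc fd; have a1 : -1 < 0 :> R by rewrite ltrN10.
have := parseval a1 (expands_lin (k := -1) fc fd).
rewrite integral0_eq; last first.
  by move=> p _; rewrite mulN1r subrr Normc.normc0 expr0n mul0r.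
move=> S0; apply/funext => n.
pose u k := (moment 0 k * normc (c k + -1 * d k) ^+ 2)%:E.
have u0 k : (0 <= u k)%E.
  by rewrite lee_fin mulr_ge0 ?sqr_ge0// ltW// moment_gt0.
have : (u n <= 0)%E.
  rewrite [leRHS]S0; apply: le_trans (nneseries_lim_ge n.+1 (fun k _ _ => u0 k)).
  by rewrite big_nat_recr//= leeDr// sume_ge0.
rewrite /u lee_fin pmulr_rle0 ?moment_gt0// => h.
have /eqP : normc (c n + -1 * d n) ^+ 2 = 0 by apply/eqP; rewrite eq_le h sqr_ge0.
rewrite sqrf_eq0 => /eqP /Normc.eq0_normc /eqP.
by rewrite mulN1r subr_eq0 => /eqP.
Qed.

Lemma taylorE f c : expands f c -> taylor f = c.
Proof.
move=> fc; apply: (@expands_inj f) => //.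
by rewrite /taylor; apply: (@getPex _ [set c | expands f c]); exists c.
Qed.

Definition space_moment H n : R := if H is Bergman a then moment a n else 1.

Lemma space_moment_gt0 H n : admissible H -> 0 < space_moment H n.
Proof. by case: H => [|a] /= h; [exact: ltr01|exact: moment_gt0]. Qed.

Lemma space_moment_step H n : admissible H ->
  n.+1%:R * space_moment H n = (gamma H + n%:R) * space_moment H n.+1.
Proof.
by case: H => [|a] /= h; [rewrite !mulr1 nat1r|exact: moment_step].
Qed.

Lemma sqnormE H f c : admissible H -> expands f c ->
  sqnorm H f = (\sum_(n <oo) (space_moment H n * normc (c n) ^+ 2)%:E)%E.
Proof.
move=> hH fc; case: H hH => [|a] /= hH.
  by rewrite (taylorE fc); apply: eq_eseriesr => n _; rewrite mul1r.
rewrite -(parseval hH fc); apply: eq_integral => p _.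
by rewrite weight_pt.
Qed.

Lemma in_spaceP H f c : admissible H -> expands f c -> in_space H f ->
  (fun N => \sum_(n < N) space_moment H n * normc (c n) ^+ 2) @ \oo --> fine (sqnorm H f).
Proof.
move=> hH fc [_]; rewrite (sqnormE hH fc); apply: nneseries_fine_cvg => n.
by rewrite mulr_ge0 ?sqr_ge0// ltW// space_moment_gt0.
Qed.

Lemma in_space_lin H f g (k : R[i]) : admissible H -> in_space H f -> in_space H g ->
  in_space H (fun z => f z + k * g z).
Proof.
move=> hH Hf Hg; have [[c fc] _] := Hf; have [[d gd] _] := Hg.
have fg := expands_lin (k := k) fc gd; split; first by eexists; exact: fg.
have m0 n := ltW (space_moment_gt0 n hH).
rewrite (sqnormE hH fg).
pose v n := 2 * (space_moment H n * normc (c n) ^+ 2) +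
  2 * normc k ^+ 2 * (space_moment H n * normc (d n) ^+ 2).
apply: (@le_lt_trans _ _ (\sum_(n <oo) (v n)%:E)%E).
  apply: lee_nneseries => [n _ _|n _]; rewrite lee_fin.
    by rewrite mulr_ge0 ?sqr_ge0.
  have -> : v n = space_moment H n * (2 * normc (c n) ^+ 2 + 2 * normc (k * d n) ^+ 2).
    by rewrite /v Normc.normcM exprMn; ring.
  rewrite ler_wpM2l//.
  rewrite !normc_sqr cReD cImD.
  move: (Re (c n)) (Im (c n)) (Re (k * d n)) (Im (k * d n)) => x y z t.
  have := sqr_ge0 (x - z); have := sqr_ge0 (y - t); nra.
apply: (@nneseries_cvg_lty _ (2 * fine (sqnorm H f) + 2 * normc k ^+ 2 * fine (sqnorm H g))).
  by move=> n; rewrite addr_ge0// !mulr_ge0 ?sqr_ge0 ?normc_ge0.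
under eq_fun do rewrite big_split/= -!mulr_sumr.
by apply: cvgD; apply: cvgM;
  [exact: cvg_cst|exact: in_spaceP|exact: cvg_cst|exact: in_spaceP].
Qed.

End Spaces.

(** * Inner products and the reproducing property *)

Section InnerProduct.
Variable R : realType.
Local Notation mR := (measurableTypeR R).
Local Notation P := (mR * mR)%type.
Local Notation D := (@unit_disk R).
Implicit Types (f g : R[i] -> R[i]) (c d : nat -> R[i]^o) (H : function_space R).

Definition inner_sum H c d N : R[i] :=
  \sum_(n < N) (space_moment H n)%:C * (c n * (d n)^*).

Definition add_scaled (k : R[i]) f g : R[i] -> R[i] := fun z => f z + k * g z.

(** The inner product recovered from norms by the real polarization identity; its
imaginary part is the real part of the inner product of f with i g. *)
Definition polarization H f g : R[i] :=
  let S F := fine (sqnorm H F) in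
  ((S (add_scaled 1 f g) - S f - S g) / 2) +i*
  ((S (add_scaled 'i%C f g) - S f - S g) / 2).

Lemma Re_polar (z w : R[i]) :
  Re (z * w^*) = (normc (z + 1 * w) ^+ 2 - normc z ^+ 2 - normc w ^+ 2) / 2.
Proof. by rewrite mul1r !normc_sqr !cReImE; field. Qed.

Lemma Im_polar (z w : R[i]) :
  Im (z * w^*) = (normc (z + 'i%C * w) ^+ 2 - normc z ^+ 2 - normc w ^+ 2) / 2.
Proof. by rewrite !normc_sqr !cReImE/=; field. Qed.

Lemma inner_sum_cvg H f g c d : admissible H -> expands f c -> expands g d ->
  in_space H f -> in_space H g ->
  (fun N => inner_sum H c d N : R[i]^o) @ \oo --> (polarization H f g : R[i]^o).
Proof.
move=> hH fc gd Hf Hg.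
have key (k : R[i]) (p : R[i] -> R) :
    (forall z w, p (z * w^*) =
      (normc (z + k * w) ^+ 2 - normc z ^+ 2 - normc w ^+ 2) / 2) ->
    (forall (x : R) z, p (x%:C * z) = x * p z) ->
    {morph p : z w / z + w} -> p 0 = 0 ->
    (fun N => p (inner_sum H c d N)) @ \oo -->
    (fine (sqnorm H (add_scaled k f g)) - fine (sqnorm H f) - fine (sqnorm H g)) / 2.
  move=> pE pZ pD p0.
  have hf := in_spaceP hH fc Hf; have hg := in_spaceP hH gd Hg.
  have hk := in_spaceP hH (expands_lin (k := k) fc gd) (in_space_lin k hH Hf Hg).
  pose T (e : nat -> R[i]^o) N := \sum_(n < N) space_moment H n * normc (e n) ^+ 2.
  have -> : (fun N => p (inner_sum H c d N)) =
      (fun N => (T (fun n => c n + k * d n) N - T c N - T d N) / 2).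
    apply/funext => N; rewrite /T /inner_sum (big_morph p pD p0) -!sumrB mulr_suml.
    by apply: eq_bigr => n _; rewrite pZ pE; ring.
  by apply: cvgM (cvg_cst _); apply: cvgB hg; exact: cvgB hk hf.
apply/cvg_complexP; split.
- apply: key; [exact: Re_polar|exact: cReZ|exact: cReD|by []].
- apply: key; [exact: Im_polar|exact: cImZ|exact: cImD|by []].
Qed.

(** For the Hardy space the series that defines the inner product converges to the
polarization; for a Bergman space the identity holds under the integral. *)
Lemma inner_polarization H f g : admissible H -> in_space H f -> in_space H g ->
  inner H f g = polarization H f g.
Proof.
move=> hH Hf Hg; have [[c fc] fy] := Hf; have [[d gd] gy] := Hg.
case: H hH Hf Hg fy gy => [|a] hH Hf Hg fy gy.
  rewrite /inner (taylorE fc) (taylorE gd).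
  apply: (@cvg_lim R[i]^o); first exact: norm_hausdorff.
  have := inner_sum_cvg hH fc gd Hf Hg.
  rewrite (_ : (fun N => _) = series (fun n => c n * (d n : R[i])^* : R[i]^o))//.
  apply/funext => N; rewrite /inner_sum /series/= big_mkord.
  by apply: eq_bigr => n _; rewrite mul1r.
have mD := @measurable_unit_disk R.
pose S (F : R[i] -> R[i]) (p : P) : R := normc (F (pt p)) ^+ 2 * weight a (pt p).
have S0 F p : 0 <= S F p.
  by rewrite mulr_ge0 ?sqr_ge0// weight_pt radial_weight_ge0.
have IS F e : expands F e -> in_space (Bergman a) F -> (@area R).-integrable D (EFin \o S F).
  move=> Fe [_ Fy]; apply/integrableP; split.
    apply/measurable_EFinP; have := measurable_sqnorm a Fe.
    by rewrite /S; under eq_fun do rewrite -weight_pt.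
  by under eq_integral do rewrite gee0_abs ?lee_fin//.
have If := IS _ _ fc Hf; have Ig := IS _ _ gd Hg.
have key (k : R[i]) (p : R[i] -> R) :
    (forall z w, p (z * w^*) =
      (normc (z + k * w) ^+ 2 - normc z ^+ 2 - normc w ^+ 2) / 2) ->
    (forall (x : R) z, p (x%:C * z) = x * p z) ->
    \int[@area R]_(q in D) p (f (pt q) * (g (pt q))^* * (weight a (pt q))%:C) =
    (fine (sqnorm (Bergman a) (add_scaled k f g)) - fine (sqnorm (Bergman a) f) -
      fine (sqnorm (Bergman a) g)) / 2.
  move=> pE pZ.
  have Ik := IS _ _ (expands_lin (k := k) fc gd) (in_space_lin k hH Hf Hg).
  rewrite -[fine (sqnorm _ (add_scaled _ _ _))]/
    (\int[@area R]_(q in D) S (add_scaled k f g) q).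
  rewrite -[fine (sqnorm _ f)]/(\int[@area R]_(q in D) S f q).
  rewrite -[fine (sqnorm _ g)]/(\int[@area R]_(q in D) S g q).
  rewrite -RintegralB// -RintegralB//; last exact: (integrableB mD Ik If).
  rewrite -RintegralZr//; last exact: (integrableB mD (integrableB mD Ik If) Ig).
  apply: eq_Rintegral => q _.
  by rewrite mulrC pZ pE /S /add_scaled; ring.
rewrite /inner /polarization/= (key 1 _ Re_polar (@cReZ R)).
by rewrite (key 'i%C _ Im_polar (@cImZ R)).
Qed.

Lemma inner_cvg H f g c d : admissible H -> expands f c -> expands g d ->
  in_space H f -> in_space H g ->
  (fun N => inner_sum H c d N : R[i]^o) @ \oo --> (inner H f g : R[i]^o).
Proof. by move=> hH *; rewrite inner_polarization//; exact: inner_sum_cvg. Qed.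

Lemma inner_conj H f g : admissible H -> in_space H f -> in_space H g ->
  inner H g f = (inner H f g)^*.
Proof.
move=> hH Hf Hg; have [[c fc] _] := Hf; have [[d gd] _] := Hg.
have h1 := inner_cvg hH gd fc Hg Hf.
have [h2 h3] := (cvg_complexP _ _).1 (inner_cvg hH fc gd Hf Hg).
apply: (cvg_unique _ h1); first exact: norm_hausdorff.
have E N : inner_sum H d c N = (inner_sum H c d N)^*.
  rewrite /inner_sum rmorph_sum; apply: eq_bigr => n _.
  by apply: complex_eqP; rewrite !cReImE/=; ring.
apply/cvg_complexP; rewrite cReJ cImJ; split.
  by under eq_fun do rewrite E cReJ.
by under eq_fun do rewrite E cImJ; exact: cvgN.
Qed.

Section Kernel.
Variable H : function_space R.
Hypothesis hH : admissible H.
Local Notation K := (repr_kernel H).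
Local Notation m := (space_moment H).

Lemma gamma_gt0 : 0 < gamma H.
Proof. by case: (H) hH => [|a] /= h; lra. Qed.

Definition kernel_coef (b : R[i]) n : R[i]^o :=
  (binomial_coef (gamma H) n)%:C * (b^*) ^+ n.

Lemma disk_conjM (b z : R[i]) : disk b -> disk z -> disk (b^* * z).
Proof.
rewrite !disk_normc => b1 z1; rewrite Normc.normcM normcJ.
by rewrite mulr_ilt1 ?normc_ge0.
Qed.

Lemma expands_kernel b : disk b -> expands (K b) (kernel_coef b).
Proof.
move=> Db; apply/expandsP => z Dz.
have := binomial_series gamma_gt0 (disk_conjM Db Dz).
rewrite (_ : (fun N => _) = (fun N => partial_sum (kernel_coef b) N z : R[i]^o))//.
apply/funext => N; rewrite /partial_sum /binomial_sum /kernel_coef.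
by apply: eq_bigr => n _; rewrite exprMn mulrA.
Qed.

Lemma space_moment_coef n : m n * binomial_coef (gamma H) n = m 0.
Proof. by apply: moment_binomial_coef => k; exact: space_moment_step. Qed.

(** The squared norm of K_b is m_0 times the expansion of K_b at the point b. *)
Lemma kernel_in_space b : disk b -> in_space H (K b).
Proof.
move=> Db; have Kb := expands_kernel Db; split; first by eexists; exact: Kb.
rewrite (sqnormE hH Kb).
have [h _] := (cvg_complexP _ _).1 ((expandsP _ _).1 Kb b Db).
have m0 n := ltW (space_moment_gt0 n hH).
apply: (@nneseries_cvg_lty _ _ (m 0 * Re (K b b))).
  by move=> n; rewrite mulr_ge0 ?sqr_ge0.
rewrite (_ : (fun N => _) = fun N => m 0 * Re (partial_sum (kernel_coef b) N b)).
  by apply: cvgM h; exact: cvg_cst.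
apply/funext => N; rewrite /partial_sum Re_sum mulr_sumr; apply: eq_bigr => n _.
rewrite -(space_moment_coef n) /kernel_coef -(mulrA _ (b^* ^+ n)) -exprMn.
rewrite conj_mul_self.
have -> : Re ((binomial_coef (gamma H) n)%:C * (normc b ^+ 2)%:C ^+ n) =
  binomial_coef (gamma H) n * (normc b ^+ 2) ^+ n by rewrite -rmorphXn -rmorphM.
rewrite Normc.normcM normc_real normcX normcJ exprMn.
rewrite real_normK ?num_real// -!exprM mulnC; ring.
Qed.

(** Since m_n kappa_n = m_0, the n-th term of the inner product is m_0 c_n b^n. *)
Lemma reproducing f b : disk b -> in_space H f -> inner H f (K b) = (m 0)%:C * f b.
Proof.
move=> Db Hf; have [[c fc] _] := Hf.
have h1 := inner_cvg hH fc (expands_kernel Db) Hf (kernel_in_space Db).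
apply: (cvg_unique _ h1); first exact: norm_hausdorff.
rewrite (_ : (fun N => _) = fun N => (m 0)%:C * partial_sum c N b).
  exact: (cvgZl_tmp (k := (m 0)%:C) ((expandsP _ _).1 fc b Db)).
apply/funext => N; rewrite /partial_sum /inner_sum mulr_sumr; apply: eq_bigr => n _.
rewrite -(space_moment_coef n) /kernel_coef.
have -> : ((binomial_coef (gamma H) n)%:C * b^* ^+ n)^* =
    (binomial_coef (gamma H) n)%:C * b ^+ n.
  have -> : b ^+ n = (b^* ^+ n)^* by rewrite -[in LHS](conjCK b) -rmorphXn.
  rewrite [LHS]rmorphM; congr (_ * _); exact: conjc_real.
rewrite [(_ * _)%:C]rmorphM; ring.
Qed.

End Kernel.
End InnerProduct.

(** * The kernel on the diagonal *)

Section KernelNorm.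
Variables (R : realType) (H : function_space R).
Hypothesis hH : admissible H.
Local Notation K := (repr_kernel H).

Lemma cpow_real (x s : R) : 0 < x -> cpow x%:C s = (x `^ s)%:C.
Proof.
move=> x0; rewrite /cpow [complex.Im _]/= mul0r atan0 mulr0 cos0 sin0 mulr0 mulr1.
by rewrite normc_real gtr0_norm.
Qed.

Lemma repr_kernel_diag (b : R[i]) : disk b ->
  K b b = ((1 - normc b ^+ 2) `^ (- gamma H))%:C.
Proof.
move=> /disk_normc b1; rewrite /repr_kernel.
have -> : 1 - b^* * b = (1 - normc b ^+ 2)%:C.
  by rewrite conj_mul_self rmorphB rmorph1.
by rewrite cpow_real// subr_gt0 expr_lt1// normc_ge0.
Qed.

Lemma repr_kernel_left0 z : K 0 z = 1.
Proof.
by rewrite /repr_kernel conjC0 mul0r subr0 -[1]/(1%:C) cpow_real// powR1.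
Qed.

Lemma repr_kernel_right0 b : K b 0 = 1.
Proof.
by rewrite /repr_kernel mulr0 subr0 -[1]/(1%:C) cpow_real// powR1.
Qed.

Lemma repr_kernel_diag_le (a b : R[i]) : disk a -> disk b ->
  (K a a <= K b b) = (`|a| <= `|b|).
Proof.
move=> Da Db; rewrite !repr_kernel_diag// !normr_normc !lecR !powRN.
move: Da Db => /disk_normc a1 /disk_normc b1.
have pos (z : R[i]) : normc z < 1 -> 0 < 1 - normc z ^+ 2.
  by move=> z1; rewrite subr_gt0 expr_lt1// normc_ge0.
rewrite lef_pV2 ?posrE ?powR_gt0 ?pos//.
have g0 := gamma_gt0 hH.
have -> : (normc a <= normc b) = (1 - normc b ^+ 2 <= 1 - normc a ^+ 2).
  by rewrite lerD2l lerN2 ler_pXn2r ?nnegrE ?normc_ge0.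
have [ba|ab] := leP (1 - normc b ^+ 2) (1 - normc a ^+ 2).
  by rewrite ge0_ler_powR ?nnegrE// ltW// pos.
by apply/negbTE; rewrite -ltNge gt0_ltr_powR ?nnegrE// ltW// pos.
Qed.
End KernelNorm.

(** * Testing on the constant function 1 *)

Section Main.
Variables (R : realType) (H : function_space R).
Hypothesis hH : admissible H.
Local Notation K := (repr_kernel H).
Local Notation m0 := ((space_moment H 0)%:C).
Variables (phi : R[i] -> R[i]) (a : R[i]).
Hypothesis hphi : forall z, disk z -> disk (phi z).
Hypothesis ha : disk a.
Local Notation A := (wcomp (K a) phi).
Local Notation one := (K 0).
Local Notation b := (phi 0).

Lemma disk0 : disk (0 : R[i]).
Proof. by rewrite /disk/= normr0 ltr01. Qed.

Lemma in_space_one : in_space H one.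
Proof. exact/kernel_in_space/disk0. Qed.

Lemma wcomp_one : A one = K a.
Proof. by apply/funext => z; rewrite /wcomp repr_kernel_left0 mulr1. Qed.

Lemma inner_one f : in_space H f -> inner H f one = m0 * f 0.
Proof. by move=> Hf; rewrite reproducing//; exact: disk0. Qed.

Lemma inner_wcomp_one f : in_space H (A f) -> inner H (A f) one = m0 * f b.
Proof. by move=> Hf; rewrite inner_one// /wcomp repr_kernel_right0 mul1r. Qed.

Lemma conj_kernel_diag c : disk c -> (m0 * K c c)^* = m0 * K c c.
Proof. by move=> Dc; rewrite repr_kernel_diag// -rmorphM; exact: conjc_real. Qed.

Lemma inner_image_one : inner H (A one) (A one) = m0 * K a a.
Proof. by rewrite wcomp_one reproducing//; exact: kernel_in_space. Qed.

(** The function B 1 is the kernel K_b without this being shown pointwise: two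
uses of the adjoint relation evaluate B 1 at b and K_b at b. *)
Lemma inner_adjoint_one B : bounded_op H A -> adjoint H A B ->
  inner H (B one) (B one) = m0 * K b b.
Proof.
move=> [Ain _ _] [Bin AB]; have H1 := in_space_one; have HB1 := Bin _ H1.
have Db := hphi disk0; have HK := kernel_in_space hH Db.
rewrite -AB// inner_wcomp_one; last exact: Ain.
rewrite -reproducing// (inner_conj hH HK HB1) -AB// inner_wcomp_one ?conj_kernel_diag//.
exact: Ain.
Qed.

Lemma eval0_adjoint_op B : bounded_op H A -> adjoint H A B ->
  m0 * B (A one) 0 = m0 * K a a.
Proof.
move=> [Ain _ _] [Bin AB]; have H1 := in_space_one.
have HA1 := Ain _ H1; have HBA1 := Bin _ HA1.
rewrite -inner_one// (inner_conj hH H1 HBA1) -AB// inner_image_one.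
exact: conj_kernel_diag.
Qed.

Lemma eval0_op_adjoint B : bounded_op H A -> adjoint H A B ->
  m0 * A (B one) 0 = m0 * K b b.
Proof.
move=> hA hAB; have [Ain _ _] := hA; have [Bin AB] := hAB; have H1 := in_space_one.
rewrite -inner_one; last exact/Ain/Bin.
by rewrite AB//; [exact: inner_adjoint_one|exact: Bin].
Qed.

Lemma m0_gt0 : 0 < m0 :> R[i].
Proof. by rewrite ltcR space_moment_gt0. Qed.

(** The pairing of (B A - A B) 1 with 1 is m_0 (K_a(a) - K_b(b)). *)
Lemma hyponormal_kernel_le : hyponormal H A -> K b b <= K a a.
Proof.
move=> [hA [B hAB pos]]; have [Ain _ _] := hA; have [Bin AB] := hAB.
have H1 := in_space_one.
have HBA := Bin _ (Ain _ H1); have HAB := Ain _ (Bin _ H1).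
have := pos _ H1.
rewrite (_ : (fun z => _) = (fun z => B (A one) z + -1 * A (B one) z)); last first.
  by apply/funext => z; rewrite mulN1r.
rewrite inner_one; last exact: in_space_lin.
rewrite mulrDr mulrCA mulN1r eval0_adjoint_op// eval0_op_adjoint//.
by rewrite subr_ge0 ler_pM2l ?m0_gt0.
Qed.

(** The adjoint A' of B that comes with the hyponormality of B is not A itself, but
the two have the same inner products with all elements of the space, and this
replaces A' by A. *)
Lemma cohyponormal_kernel_le : cohyponormal H A -> K a a <= K b b.
Proof.
move=> [hA [B hAB [hB [A' hBA' pos]]]]; have [Ain _ _] := hA; have [Bin AB] := hAB.
have [A'in BA'] := hBA'.
have H1 := in_space_one.
have HBA := Bin _ (A'in _ H1); have HAB := A'in _ (Bin _ H1).
have inner_A' f g : in_space H f -> in_space H g -> inner H f (A' g) = inner H f (A g).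
  move=> Hf Hg; rewrite -BA'// (inner_conj hH (Ain _ Hg) Hf) AB//.
  by rewrite (inner_conj hH Hg (Bin _ Hf)).
have := pos _ H1.
rewrite (_ : (fun z => _) = (fun z => A' (B one) z + -1 * B (A' one) z)); last first.
  by apply/funext => z; rewrite mulN1r.
rewrite inner_one; last exact: in_space_lin.
rewrite mulrDr mulrCA mulN1r.
have -> : m0 * A' (B one) 0 = m0 * K b b.
  rewrite -inner_one// (inner_conj hH H1 HAB) -BA'//; last exact: Bin.
  by rewrite inner_adjoint_one// conj_kernel_diag//; exact/hphi/disk0.
have -> : m0 * B (A' one) 0 = m0 * K a a.
  rewrite -inner_one// BA'//; last exact: A'in.
  rewrite inner_A'//; last exact: A'in.
  rewrite (inner_conj hH (Ain _ H1) (A'in _ H1)) inner_A'//; last exact: Ain.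
  by rewrite inner_image_one conj_kernel_diag.
by rewrite subr_ge0 ler_pM2l ?m0_gt0.
Qed.

Lemma normal_kernel_eq : normal_op H A -> K a a = K b b.
Proof.
move=> [hA [B hAB eqAB]]; apply: (mulfI (lt0r_neq0 m0_gt0)).
rewrite -(eval0_adjoint_op hA hAB) -(eval0_op_adjoint hA hAB).
by rewrite (eqAB _ in_space_one _ disk0).
Qed.

End Main.

Theorem proposition3p4 (R : realType) (H : function_space R)
    (hH : admissible H) (phi : R[i] -> R[i]) (hphi : self_map phi)
    (a : R[i]) (ha : disk a) :
  let C := wcomp (repr_kernel H a) phi in
  [/\ cohyponormal H C -> `|a| <= `|phi 0|,
      hyponormal H C -> `|phi 0| <= `|a|
    & normal_op H C -> `|phi 0| = `|a|].
Proof.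
have hphi' := hphi.2; have Db := hphi' _ (@disk0 R).
move=> C; split=> hC.
- rewrite -(repr_kernel_diag_le hH ha Db); exact: cohyponormal_kernel_le hC.
- rewrite -(repr_kernel_diag_le hH Db ha); exact: hyponormal_kernel_le hC.
- apply/eqP; rewrite eq_le -!(repr_kernel_diag_le hH)//.
  by rewrite (normal_kernel_eq hH hphi' ha hC) lexx.
Qed.
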